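(* Let $G$ be a discrete group, let $Y$ be an affine $G$-CW complex together with a $G$-Morse function $h\colon Y\to\mathbb{R}$, and let $t<s$ in $\mathbb{R}$ with $Y^{(0)}\cap h^{-1}\bigl((t,s)\bigr)=\emptyset$. Let $P$ be the pushout of the diagram of $G$-spaces and $G$-maps $$\coprod_{y\in Y^{(0)}\cap h^{-1}(s)}\operatorname{st}_\downarrow y\ \hookleftarrow\ \coprod_{y\in Y^{(0)}\cap h^{-1}(s)}\operatorname{lk}_\downarrow y\ \xrightarrow{\ \Phi\ }\ Y^{h\le t}.$$ Then the natural map $P\to Y^{h\le s}$, induced by the inclusion $Y^{h\le t}\hookrightarrow Y^{h\le s}$ and the map $\Psi\colon\coprod_{y\in Y^{(0)}\cap h^{-1}(s)}\operatorname{st}_\downarrow y\to Y^{h\le s}$, is a $G$-homotopy equivalence.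
   Context: A $G$-CW complex is a CW complex with a $G$-action (permuting the open cells) such that, for all open cells $e$ and all $g\in G$, if $g\cdot e\cap e\neq\emptyset$ then $g\cdot x=x$ for all $x\in e$. $Y^{(0)}$ denotes the set of vertices. An affine $G$-CW complex is a $G$-CW complex $Y$ with a chosen CW structure such that: (0) $Y$ is a regular CW complex, i.e., characteristic maps are homeomorphisms (onto closed cells); (1) each closed cell $e$ of $Y$ has a chosen characteristic map $\chi_e\colon C_e\to e$ with $C_e$ a convex polyhedron in some euclidean space $\mathbb{R}^{n_e}$; an admissible characteristic map for $e$ is any composite $C\xrightarrow{\alpha}C_e\xrightarrow{\chi_e}e$ where $C$ is a convex polyhedron in some $\mathbb{R}^m$ and $\alpha$ is an affine homeomorphism, i.e., a homeomorphism obtained by restricting an affine map $\mathbb{R}^m\to\mathbb{R}^{n_e}$; (2) for each cell $e$, the restriction of $\chi_e$ to any face of $C_e$ is an admissible characteristic map for some face $e'$ of $e$; (3) for each cell $e$ and each $g\in G$, $g\circ\chi_e$ is an admissible characteristic map for $g\cdot e$. A $G$-Morse function on $Y$ is a $G$-equivariant map $h\colon Y\to\mathbb{R}$ (trivial action on $\mathbb{R}$) such that: (1) $h(Y^{(0)})$ is closed and discrete in $\mathbb{R}$; (2) $h$ is nonconstant on edges; (3) for each cell $e$, $h\circ\chi_e\colon C_e\to\mathbb{R}$ is the restriction of an affine map $\mathbb{R}^{n_e}\to\mathbb{R}$. On each cell $e$, $h$ attains its maximum at a unique vertex, called the top vertex of $e$. Set $Y^{h\le r}=h^{-1}\bigl((-\infty,r]\bigr)$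 for $r\in\mathbb{R}$. For a vertex $y$ with $h(y)=s$ (and $t$ as in the claim, so that no vertex has $h$-value in $(t,s)$), the descending link $\operatorname{lk}_\downarrow y$ (at level $t$) is the subspace of $Y$ that is the union of all closed cells with top vertex $y$, intersected with $h^{-1}(t)$; the descending star $\operatorname{st}_\downarrow y$ is the union of all closed cells with top vertex $y$, intersected with $h^{-1}([t,s])$. It contains $\operatorname{lk}_\downarrow y$ and is a cone on it. The coproducts are disjoint unions (not unions inside $Y$). $G$ acts on them by letting $g\in G$ map the summand $\operatorname{lk}_\downarrow y$ (respectively $\operatorname{st}_\downarrow y$) to the summand $\operatorname{lk}_\downarrow(g\cdot y)$ (respectively $\operatorname{st}_\downarrow(g\cdot y)$) via the action on $Y$. The map $\Phi$ (respectively $\Psi$) is the $G$-map whose restriction to each summand is the inclusion of $\operatorname{lk}_\downarrow y$ into $Y^{h\le t}$ (respectively of $\operatorname{st}_\downarrow y$ into $Y^{h\le s}$), and the left-hand map of the diagram is the disjoint union of the inclusions $\operatorname{lk}_\downarrow y\hookrightarrow\operatorname{st}_\downarrow y$. *)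

(* Defs.v *)
From Stdlib Require Import Relation_Operators.
From HB Require Import structures.
From mathcomp Require Import all_boot all_order all_algebra generic_quotient.
From mathcomp Require Import boolp classical_sets functions cardinality reals.
From mathcomp Require Import topology normedtype.

Set Implicit Arguments.
Unset Strict Implicit.
Unset Printing Implicit Defensive.

Import Order.TTheory GRing.Theory Num.Theory.
Import numFieldTopology.Exports.

Local Open Scope classical_set_scope.
Local Open Scope ring_scope.

Definition homeo_onto (X Y : topologicalType) (A : set X) (B : set Y)
    (f : X -> Y) : Prop :=
  [/\ set_bij A B f, {within A, continuous f} &
      exists g : Y -> X,
        (forall x, A x -> g (f x) = x) /\ {within B, continuous g}].

Section Polyhedra.
Context {R : realType}.

Definition affine_map m n (f : 'rV[R]_m -> 'rV[R]_n) : Prop :=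
  exists (M : 'M[R]_(m, n)) (b : 'rV[R]_n), forall x, f x = x *m M + b.

Definition affine_form m (f : 'rV[R]_m -> R) : Prop :=
  exists (u : 'cV[R]_m) (c : R), forall x, f x = (x *m u) 0 0 + c.

(* A finite intersection of closed half-spaces.  Compactness is part of the
   notion here: domains of characteristic maps are homeomorphic to balls. *)
Definition convex_polyhedron n (C : set 'rV[R]_n) : Prop :=
  compact C /\
  exists k (M : 'M[R]_(n, k)) (b : 'rV[R]_k),
    C = [set x | forall i, (x *m M) 0 i <= b 0 i].

(* Nonempty faces, C itself included (u = 0, c = 0). *)
Definition face n (C F : set 'rV[R]_n) : Prop :=
  F !=set0 /\
  exists (u : 'cV[R]_n) (c : R),
    (forall x, C x -> (x *m u) 0 0 <= c) /\
    F = C `&` [set x | (x *m u) 0 0 = c].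

Definition aff_hull n (C : set 'rV[R]_n) : set 'rV[R]_n :=
  [set x | exists k (p : 'I_k -> 'rV[R]_n) (a : 'I_k -> R),
     [/\ forall i, C (p i), \sum_i a i = 1 & x = \sum_i a i *: p i]].

Definition relint n (C : set 'rV[R]_n) : set 'rV[R]_n :=
  [set x | aff_hull C x /\ within (aff_hull C) (nbhs x) C].

Definition has_dim n (C : set 'rV[R]_n) (d : nat) : Prop :=
  exists (p : 'rV[R]_n) (B : 'M[R]_(d, n)),
    row_free B /\ aff_hull C = [set p + u *m B | u in [set: 'rV[R]_d]].

Definition unit_ball n : set 'rV[R]_n := [set x | \sum_i x 0 i ^+ 2 <= 1].
Definition open_unit_ball n : set 'rV[R]_n := [set x | \sum_i x 0 i ^+ 2 < 1].
Definition unit_sphere n : set 'rV[R]_n := [set x | \sum_i x 0 i ^+ 2 = 1].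

End Polyhedra.

Section CW.
Context {R : realType} {Y : topologicalType}.

(* [cell i] are the open cells; the closed cells are their closures. *)
Definition characteristic_map (I : Type) (dim : I -> nat) (cell : I -> set Y)
    (i : I) (phi : 'rV[R]_(dim i) -> Y) : Prop :=
  [/\ {within unit_ball (n := dim i), continuous phi},
      homeo_onto (open_unit_ball (n := dim i)) (cell i) phi &
      exists J : set I, [/\ finite_set J, (forall j, J j -> (dim j < dim i)%N) &
        phi @` unit_sphere (n := dim i) `<=` \bigcup_(j in J) cell j]].

End CW.

Record CWcomplex (R : realType) (Y : topologicalType) := {
  cell_index : Type;
  dim : cell_index -> nat;
  cell : cell_index -> set Y;
  cw_hausdorff : hausdorff_space Y;
  cw_cover : \bigcup_i cell i = setT;
  cw_disjoint : forall i j, cell i `&` cell j !=set0 -> i = j;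
  cw_char : forall i, exists phi : 'rV[R]_(dim i) -> Y,
    characteristic_map cell phi;
  cw_weak : forall A : set Y,
    (forall i, closed (A `&` closure (cell i))) -> closed A }.

Section CWTheory.
Context {R : realType} {Y : topologicalType} (K : CWcomplex R Y).

Definition closed_cell (i : cell_index K) : set Y := closure (cell i).

Definition vertex : set Y := [set y | exists2 i, dim i = 0%N & @cell R Y K i y].

Definition regular_CW : Prop :=
  forall i : cell_index K, exists phi : 'rV[R]_(dim i) -> Y,
    characteristic_map (@cell R Y K) phi /\
    homeo_onto (unit_ball (n := dim i)) (closed_cell i) phi.

End CWTheory.

(* G is discrete: joint continuity amounts to continuity of each translation. *)
Record is_action (G : groupType) (X : topologicalType) (a : G -> X -> X) :
    Prop := {
  act1 : forall x, a 1%g x = x;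
  actM : forall g1 g2 x, a (g1 * g2)%g x = a g1 (a g2 x);
  act_continuous : forall g, continuous (a g) }.

Definition G_map (G : groupType) (X Z : topologicalType)
    (a : G -> X -> X) (b : G -> Z -> Z) (f : X -> Z) : Prop :=
  continuous f /\ forall g x, f (a g x) = b g (f x).

Definition G_homotopic (R : realType) (G : groupType) (X Z : topologicalType)
    (a : G -> X -> X) (b : G -> Z -> Z) (f0 f1 : X -> Z) : Prop :=
  exists H : X * R -> Z,
    [/\ {within [set: X] `*` [set r : R | 0 <= r <= 1], continuous H},
        forall g x r, 0 <= r <= 1 -> H (a g x, r) = b g (H (x, r)),
        forall x, H (x, 0) = f0 x &
        forall x, H (x, 1) = f1 x].

Definition G_homotopy_equivalence (R : realType) (G : groupType)
    (X Z : topologicalType) (a : G -> X -> X) (b : G -> Z -> Z)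
    (f : X -> Z) : Prop :=
  G_map a b f /\
  exists k : Z -> X,
    [/\ G_map b a k, G_homotopic R a a (k \o f) id &
        G_homotopic R b b (f \o k) id].

Definition is_GCW (R : realType) (G : groupType) (Y : topologicalType)
    (K : CWcomplex R Y) (a : G -> Y -> Y) : Prop :=
  [/\ is_action a,
      forall g (i : cell_index K), exists j : cell_index K,
        a g @` cell i = cell j &
      forall g (i : cell_index K),
        (a g @` cell i) `&` cell i !=set0 -> forall x, cell i x -> a g x = x].

Section Admissible.
Context {R : realType} {Y : topologicalType} (K : CWcomplex R Y).
Variables (amb : cell_index K -> nat).
Variables (poly : forall i, set 'rV[R]_(amb i)).
Variables (chi : forall i, 'rV[R]_(amb i) -> Y).

(* Beyond the homeomorphism onto the closed cell, a characteristic map has a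
   domain of the dimension of the cell, and restricts to a homeomorphism of the
   interior of its domain onto the open cell. *)
Definition polyhedral_characteristic_map (i : cell_index K) n
    (C : set 'rV[R]_n) (f : 'rV[R]_n -> Y) : Prop :=
  [/\ convex_polyhedron C, has_dim C (dim i), homeo_onto C (closed_cell i) f &
      f @` relint C = cell i].

Definition admissible (i : cell_index K) m (C : set 'rV[R]_m)
    (f : 'rV[R]_m -> Y) : Prop :=
  convex_polyhedron C /\
  exists alpha : 'rV[R]_m -> 'rV[R]_(amb i),
    [/\ affine_map alpha, homeo_onto C (poly (i := i)) alpha &
        forall x, C x -> f x = chi (alpha x)].

End Admissible.

Record affineGCW (R : realType) (G : groupType) (Y : topologicalType) := {
  cw :> CWcomplex R Y;
  act : G -> Y -> Y;
  affine_GCW : is_GCW cw act;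
  affine_regular : regular_CW cw;
  amb : cell_index cw -> nat;
  poly : forall i, set 'rV[R]_(amb i);
  chi : forall i, 'rV[R]_(amb i) -> Y;
  chi_char : forall i,
    polyhedral_characteristic_map i (@poly i) (@chi i);
  chi_face : forall i F, face (@poly i) F ->
    exists2 j, closed_cell j `<=` closed_cell i &
      admissible poly chi j F (@chi i);
  chi_act : forall g i j, act g @` cell i = cell j ->
    admissible poly chi j (@poly i) (act g \o @chi i) }.

Record is_Gmorse (R : realType) (G : groupType) (Y : topologicalType)
    (K : affineGCW R G Y) (h : Y -> R) : Prop := {
  morse_continuous : continuous h;
  morse_act : forall g y, h (act K g y) = h y;
  morse_closed : closed (h @` vertex K);
  morse_discrete : forall r, (h @` vertex K) r -> isolated (h @` vertex K) r;
  morse_edge : forall i : cell_index K, dim i = 1%N ->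
    exists x y, [/\ closed_cell i x, closed_cell i y & h x <> h y];
  morse_affine : forall i : cell_index K, exists2 f : 'rV[R]_(amb i) -> R,
    affine_form f & forall x, poly x -> h (chi x) = f x }.

Section SubAction.
Context {G : groupType} {Y : topologicalType} (a : G -> Y -> Y) (A : set Y).
Hypothesis aA : forall g x, A x -> A (a g x).

Definition sub_act (g : G) (x : A) : A :=
  exist _ (a g (\val x)) (mem_set (aA g (set_valP x))).

Lemma sub_act_is_action : is_action a -> is_action sub_act.
Proof.
move=> [a1 aM ac]; split.
- by move=> x; apply: val_inj; rewrite /= a1.
- by move=> g1 g2 x; apply: val_inj; rewrite /= aM.
- move=> g; apply: continuous_comp_initial.
  move=> x; apply: (@continuous_comp A Y Y set_val (a g)); last exact: ac.
  exact: (@initial_continuous A Y set_val).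
Qed.

End SubAction.

Section Coproduct.
Context {G : groupType} {Y : topologicalType} (a : G -> Y -> Y).
Context (V : set Y) (S : Y -> set Y).
Hypothesis aV : forall g y, V y -> V (a g y).
Hypothesis aS : forall g y x, S y x -> S (a g y) (a g x).

Definition coprod : topologicalType := {y : V & S (\val y)}.

Definition coprod_act (g : G) (p : coprod) : coprod :=
  existT (fun y : V => S (\val y)) (sub_act aV g (projT1 p))
    (exist _ (a g (\val (projT2 p))) (mem_set (aS g (set_valP (projT2 p))))).

Lemma coprod_eq (p q : coprod) : projT1 p = projT1 q ->
  \val (projT2 p) = \val (projT2 q) -> p = q.
Proof.
case: p q => [y x] [z w] /= yz; case: z / yz w => w xw.
by congr existT; exact: val_inj.
Qed.

Lemma coprod_act_is_action : is_action a -> is_action coprod_act.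
Proof.
move=> [a1 aM ac]; split.
- move=> p; apply: coprod_eq; last by rewrite /= a1.
  by apply: val_inj; rewrite /= a1.
- move=> g1 g2 p; apply: coprod_eq; last by rewrite /= aM.
  by apply: val_inj; rewrite /= aM.
- move=> g [y x].
  have c : continuous (fun x : S (\val y) =>
      (exist _ (a g (\val x)) (mem_set (aS g (set_valP x)))
        : S (\val (sub_act aV g y)))).
    apply: continuous_comp_initial => z.
    apply: (@continuous_comp (S (\val y)) Y Y set_val (a g)); last exact: ac.
    exact: (@initial_continuous (S (\val y)) Y set_val).
  move=> U nU; have := c x _ nU; exact.
Qed.

End Coproduct.

Section CoproductMaps.
Context {Y : topologicalType} (V : set Y).

Definition coprod_incl (S T : Y -> set Y) (ST : forall y, S y `<=` T y)
    (p : coprod V S) : coprod V T :=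
  existT (fun y : V => T (\val y)) (projT1 p) (subfun (ST _) (projT2 p)).

Definition coprod_fold (S : Y -> set Y) (B : set Y)
    (SB : forall y, V y -> S y `<=` B) (p : coprod V S) : B :=
  subfun (SB _ (set_valP (projT1 p))) (projT2 p).

End CoproductMaps.

Section Pushout.
Context {A B C : topologicalType} (f : A -> B) (g : A -> C).
Local Open Scope quotient_scope.

Definition pushout_summand (b : bool) : topologicalType := if b then B else C.
Definition pushout_sum : topologicalType := {b : bool & pushout_summand b}.
Definition sum_inl (x : B) : pushout_sum := existT pushout_summand true x.
Definition sum_inr (x : C) : pushout_sum := existT pushout_summand false x.

Inductive pushout_glue : pushout_sum -> pushout_sum -> Prop :=
  PushoutGlue a : pushout_glue (sum_inl (f a)) (sum_inr (g a)).

Definition pushout_relb (x y : pushout_sum) : bool :=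
  `[< clos_refl_sym_trans _ pushout_glue x y >].

Lemma pushout_relb_refl : reflexive pushout_relb.
Proof. by move=> x; apply/asboolP; exact: rst_refl. Qed.

Lemma pushout_relb_sym : symmetric pushout_relb.
Proof. by move=> x y; apply/asboolP/asboolP; exact: rst_sym. Qed.

Lemma pushout_relb_trans : transitive pushout_relb.
Proof.
move=> y x z /asboolP xy /asboolP yz; apply/asboolP; exact: rst_trans yz.
Qed.

Definition pushout_rel :=
  EquivRel pushout_relb pushout_relb_refl pushout_relb_sym pushout_relb_trans.

Definition pushout := {eq_quot pushout_rel}.

HB.instance Definition _ := Topological.copy pushout (quotient_topology pushout).
HB.instance Definition _ := Quotient.on pushout.

Definition pushout_inl (x : B) : pushout := \pi_pushout (sum_inl x).
Definition pushout_inr (x : C) : pushout := \pi_pushout (sum_inr x).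

Lemma pushout_inl_continuous : continuous pushout_inl.
Proof.
move=> x; apply: (@continuous_comp _ pushout_sum); last exact: pi_continuous.
exact: (@existT_continuous _ pushout_summand true).
Qed.

Lemma pushout_inr_continuous : continuous pushout_inr.
Proof.
move=> x; apply: (@continuous_comp _ pushout_sum); last exact: pi_continuous.
exact: (@existT_continuous _ pushout_summand false).
Qed.

Lemma pushout_comm a : pushout_inl (f a) = pushout_inr (g a).
Proof. by apply/eqmodP/asboolP; exact: rst_step. Qed.

Lemma pushout_ind (P : pushout -> Prop) :
  (forall x, P (pushout_inl x)) -> (forall x, P (pushout_inr x)) ->
  forall p, P p.
Proof.
move=> Pl Pr p; rewrite -[p]reprK; case: (repr p) => -[] x;
  [exact: Pl|exact: Pr].
Qed.

Section Map.
Context {Z : Type} (u : B -> Z) (v : C -> Z).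

Definition sum_case (x : pushout_sum) : Z :=
  let: existT b x := x in
  (if b return pushout_summand b -> Z then u else v) x.

(* The map out of the pushout induced by u and v.  Its value on a class is
   computed on a chosen representative; the choice is immaterial as soon as
   u and v agree on A (pushout_map_inl, pushout_map_inr). *)
Definition pushout_map (p : pushout) : Z := sum_case (repr p).

Hypothesis uv : forall a, u (f a) = v (g a).

Lemma pushout_map_pi x : pushout_map (\pi_pushout x) = sum_case x.
Proof.
rewrite /pushout_map; case: piP => y /eqmodP/asboolP.
elim=> {x y} [_ _ [a]|//|x y _ -> //|x y z _ -> _ -> //].
by rewrite /= uv.
Qed.

Lemma pushout_map_inl x : pushout_map (pushout_inl x) = u x.
Proof. exact: pushout_map_pi. Qed.

Lemma pushout_map_inr x : pushout_map (pushout_inr x) = v x.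
Proof. exact: pushout_map_pi. Qed.

End Map.

Lemma pushout_map_continuous (Z : topologicalType) (u : B -> Z) (v : C -> Z) :
  (forall a, u (f a) = v (g a)) -> continuous u -> continuous v ->
  continuous (pushout_map u v).
Proof.
move=> uv cu cv; apply/(quotient_continuous (Q0 := pushout)).
rewrite (_ : _ \o _ = sum_case u v).
  2: by apply/funext => x; exact: pushout_map_pi.
move=> [[] x] U nU; [exact: cu|exact: cv].
Qed.

End Pushout.

Section PushoutAction.
Context {G : groupType} {A B C : topologicalType} (f : A -> B) (g : A -> C).
Context (aA : G -> A -> A) (aB : G -> B -> B) (aC : G -> C -> C).

Definition pushout_act (k : G) : pushout f g -> pushout f g :=
  pushout_map (pushout_inl f g \o aB k) (pushout_inr f g \o aC k).

Lemma pushout_act_is_action :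
  (forall k x, f (aA k x) = aB k (f x)) ->
  (forall k x, g (aA k x) = aC k (g x)) ->
  is_action aB -> is_action aC -> is_action pushout_act.
Proof.
move=> fG gG [B1 BM Bc] [C1 CM Cc].
have E k a : (pushout_inl f g \o aB k) (f a) = (pushout_inr f g \o aC k) (g a).
  by rewrite /= -fG -gG pushout_comm.
split.
- by apply: pushout_ind => x; rewrite /pushout_act
    ?(pushout_map_inl (E _)) ?(pushout_map_inr (E _)) /= ?B1 ?C1.
- by move=> k l; apply: pushout_ind => x; rewrite /pushout_act
    ?(pushout_map_inl (E _)) ?(pushout_map_inr (E _)) /=
    ?(pushout_map_inl (E _)) ?(pushout_map_inr (E _)) /= ?BM ?CM.
- move=> k; apply: pushout_map_continuous => [|x|x]; first exact: E.
    by apply: continuous_comp; [exact: Bc|exact: pushout_inl_continuous].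
  by apply: continuous_comp; [exact: Cc|exact: pushout_inr_continuous].
Qed.

End PushoutAction.

Section Morse.
Context {R : realType} {G : groupType} {Y : topologicalType}.
Context (K : affineGCW R G Y) (h : Y -> R).

(* That such a y is unique follows from [morse_edge] and [morse_affine]. *)
Definition top_vertex (i : cell_index K) (y : Y) : Prop :=
  [/\ vertex K y, closed_cell i y & forall z, closed_cell i z -> h z <= h y].

Definition cells_below (y : Y) : set Y :=
  \bigcup_(i in [set i | top_vertex i y]) closed_cell i.

Definition desc_link (t : R) (y : Y) : set Y :=
  cells_below y `&` [set x | h x = t].

Definition desc_star (t s : R) (y : Y) : set Y :=
  cells_below y `&` [set x | t <= h x <= s].

Definition sublevel (r : R) : set Y := [set x | h x <= r].

Definition vertices_at (r : R) : set Y := [set y | vertex K y /\ h y = r].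

Hypothesis hM : is_Gmorse K h.

Lemma act_is_action : is_action (act K).
Proof. by case: (affine_GCW K). Qed.

Lemma actVK g y : act K g (act K g^-1%g y) = y.
Proof. by rewrite -(actM act_is_action) mulgV (act1 act_is_action). Qed.

Lemma actKV g y : act K g^-1%g (act K g y) = y.
Proof. by rewrite -(actM act_is_action) mulVg (act1 act_is_action). Qed.

Lemma vertex_act g y : vertex K y -> vertex K (act K g y).
Proof.
move=> [i di iy]; have [_ /(_ g i)[j gij] _] := affine_GCW K.
exists j; last by rewrite -gij; exists y.
have cell_eq x : cell i x -> x = y.
  have [phi [_ [bij _ _] _]] := cw_char i.
  move=> ix; case: bij => _ _ phi_surj.
  have [u _ <-] := phi_surj _ ix; have [v _ <-] := phi_surj _ iy.
  congr phi; apply/matrixP => a b; exfalso; case: b => b; by rewrite di.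
case dj : (dim j) => [//|d]; exfalso.
have [phi [_ [[phi_fun phi_inj _] _ _] _]] := cw_char j.
have jE x : cell j x -> x = act K g y.
  by rewrite -gij => -[z /cell_eq -> <-].
have lt0d : (0 < dim j)%N by rewrite dj.
pose e := \row_(k < dim j) (if k == Ordinal lt0d then 2^-1 else 0 : R).
have b0 : open_unit_ball (0 : 'rV[R]_(dim j)).
  by rewrite /open_unit_ball /= big1 ?ltr01// => k _; rewrite mxE expr0n.
have be : open_unit_ball e.
  rewrite /open_unit_ball /= (bigD1 (Ordinal lt0d))//= big1 => [|k /negPf k0].
    by rewrite addr0 mxE eqxx expr_lt1 ?invf_lt1 ?invr_ge0 ?ltr1n.
  by rewrite mxE k0 expr0n.
have : e = 0.
  apply: phi_inj; rewrite ?inE //.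
  by rewrite (jE _ (phi_fun _ be)) (jE _ (phi_fun _ b0)).
move=> /matrixP/(_ 0 (Ordinal lt0d)); rewrite !mxE eqxx => /eqP.
by rewrite invr_eq0 pnatr_eq0.
Qed.

Lemma closed_cell_act g (i j : cell_index K) x : act K g @` cell i = cell j ->
  closed_cell i x -> closed_cell j (act K g x).
Proof.
move=> gij ix U nU.
have [z [iz Uz]] := ix _ (act_continuous act_is_action nU).
by exists (act K g z); split => //; rewrite -gij; exists z.
Qed.

Lemma top_vertex_act g (i j : cell_index K) y : act K g @` cell i = cell j ->
  top_vertex i y -> top_vertex j (act K g y).
Proof.
move=> gij [vy iy max]; split; first exact: vertex_act.
  exact: closed_cell_act iy.
have gji : act K g^-1%g @` cell j = cell i.
  rewrite -gij; apply/seteqP; split=> [_ [_ [x ix <-] <-]|x ix].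
    by rewrite actKV.
  by exists (act K g x); [exists x|rewrite actKV].
move=> z jz; rewrite (morse_act hM) -(morse_act hM g^-1%g z).
exact/max/(closed_cell_act gji).
Qed.

Lemma cells_below_act g y x :
  cells_below y x -> cells_below (act K g y) (act K g x).
Proof.
move=> [i iy ix]; have [_ /(_ g i)[j gij] _] := affine_GCW K.
by exists j; [exact: top_vertex_act iy|exact: closed_cell_act ix].
Qed.

Lemma desc_link_act t g y x :
  desc_link t y x -> desc_link t (act K g y) (act K g x).
Proof.
by case=> yx hx; split; [exact: cells_below_act|rewrite /= (morse_act hM)].
Qed.

Lemma desc_star_act t s g y x :
  desc_star t s y x -> desc_star t s (act K g y) (act K g x).
Proof.
by case=> yx hx; split; [exact: cells_below_act|rewrite /= (morse_act hM)].
Qed.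

Lemma sublevel_actP r g x : sublevel r x -> sublevel r (act K g x).
Proof. by rewrite /sublevel /= (morse_act hM). Qed.

Lemma vertices_at_act r g y : vertices_at r y -> vertices_at r (act K g y).
Proof. by case=> /(vertex_act g) vy hy; split=> //; rewrite (morse_act hM). Qed.

Lemma desc_link_star t s y : t <= s -> desc_link t y `<=` desc_star t s y.
Proof. by move=> ts x [yx hx]; split=> //=; rewrite hx lexx ts. Qed.

Lemma desc_link_sublevel t y : desc_link t y `<=` sublevel t.
Proof. by move=> x [_ /= hx]; rewrite /sublevel /= hx. Qed.

Lemma desc_star_sublevel t s y : desc_star t s y `<=` sublevel s.
Proof. by move=> x [_ /= /andP[_]]. Qed.

Lemma sublevelS t s : t <= s -> sublevel t `<=` sublevel s.
Proof. by move=> ts x /= /le_trans; apply. Qed.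

Definition sublevel_act (r : R) : G -> sublevel r -> sublevel r :=
  sub_act (sublevel_actP (r := r)).

Variables (t s : R) (ts : t <= s).

Definition links : topologicalType := coprod (vertices_at s) (desc_link t).
Definition stars : topologicalType := coprod (vertices_at s) (desc_star t s).

Definition links_act : G -> links -> links :=
  coprod_act (vertices_at_act (r := s)) (desc_link_act (t := t)).
Definition stars_act : G -> stars -> stars :=
  coprod_act (vertices_at_act (r := s)) (desc_star_act (t := t) (s := s)).

Definition links_stars : links -> stars :=
  coprod_incl (fun y => desc_link_star (y := y) ts).
Definition Phi : links -> sublevel t :=
  coprod_fold (fun y _ => desc_link_sublevel (t := t) (y := y)).
Definition Psi : stars -> sublevel s :=
  coprod_fold (fun y _ => desc_star_sublevel (t := t) (s := s) (y := y)).

Definition morse_pushout : topologicalType := pushout links_stars Phi.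

Definition morse_pushout_act : G -> morse_pushout -> morse_pushout :=
  pushout_act stars_act (sublevel_act (r := t)).

Definition natural_map : morse_pushout -> sublevel s :=
  pushout_map Psi (subfun (sublevelS ts)).

Lemma morse_pushout_act_is_action : is_action morse_pushout_act.
Proof.
apply: (pushout_act_is_action (aA := links_act)).
- by move=> g p; apply: coprod_eq.
- by move=> g p; apply: val_inj.
- exact/coprod_act_is_action/act_is_action.
- exact/sub_act_is_action/act_is_action.
Qed.

Lemma Psi_Phi p : Psi (links_stars p) = subfun (sublevelS ts) (Phi p).
Proof. exact: val_inj. Qed.

Lemma natural_map_star x : natural_map (pushout_inl _ _ x) = Psi x.
Proof. exact: (pushout_map_inl Psi_Phi). Qed.

Lemma natural_map_sublevel x :
  natural_map (pushout_inr _ _ x) = subfun (sublevelS ts) x.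
Proof. exact: (pushout_map_inr Psi_Phi). Qed.

End Morse.

Arguments morse_pushout_act {R G Y K h} hM {t s} ts.
Arguments sublevel_act {R G Y K h} hM r.
Arguments natural_map {R G Y} K h {t s} ts.

(* Main.v *)
From mathcomp Require Import all_boot all_order all_algebra.
From mathcomp Require Import boolp classical_sets functions cardinality reals.
From mathcomp Require Import topology normedtype derive.
From mathcomp Require Import ring lra.
Require Import Defs.

Set Implicit Arguments.
Unset Strict Implicit.
Unset Printing Implicit Defensive.

(** The proof pushes every point of the sublevel set at [s] away from the high
    vertices, cell by cell, until it reaches the image of the pushout.

    Each closed cell [j] has a unique highest point [top j], a vertex: the points
    of maximal height form a face, hence a closed cell on which [h] is constant,
    and such a cell has dimension 0 ([nonconstant_cell]: a cell of dimension at
    least 2 has a proper face with two points, so constancy would descend to an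
    edge).
    A point of [j] other than [top j] can be pushed straight away from [top j]
    until it leaves [j]; this map [proj j] is continuous, lowers [h], and lands
    in faces of [j] that do not contain [top j].

    Call carrier of [x] the open cell containing [x].  As long as the carrier of
    [x] has its top above [s], replace [x] by its projection away from that top.
    Carriers get smaller, so this stops at a point [retr x] whose carrier has its
    top at height at most [s].  Since no vertex lies strictly between [t] and
    [s], that top is either at [s], and [retr x] is in its descending star or
    below [t], or it is at most [t].  So [retr x] is in the image of the natural
    map.  (Geometrically, pulling all top vertices triangulates [Y] without new
    vertices, and [retr] deletes the barycentric coordinates at the vertices
    above [s] and rescales the others.)

    A single push is not continuous across cells, because a face that misses
    [top j] is pushed from its own top.  But on a fixed closed cell [j] one has
    [retr x = retr (proj j x)] ([retr_proj_closed]), and [proj j] lands in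
    smaller cells, so [retr] is continuous on each closed cell by induction on
    the dimension ([retr_continuous_cell]).  The weak topology glues these
    restrictions, also in the presence of a homotopy parameter
    ([cw_within_prod]).

    Since [retr x] stays in the closed carrier of [x], the segment joining them
    in any chart gives a homotopy [slide] from [retr] to the identity.  It
    never raises [h] and never leaves the closed carrier; hence it preserves the
    sublevel set at [s] and also the image of the natural map.  The natural map
    is injective ([natural_map_inj]) and its inverse is continuous on the image
    cut with each closed cell ([inverse_continuous]).  So the inverse composed
    with [retr] is a homotopy inverse, and [slide] provides both homotopies.
    Everything is determined by [h] and the affine structure of the cells, which
    [G] preserves; this makes all maps equivariant ([act_slide]). *)

Import Order.TTheory GRing.Theory Num.Theory.
Import numFieldTopology.Exports.
Local Open Scope classical_set_scope.
Local Open Scope ring_scope.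

(** * Continuity on subsets *)

Lemma within_comp (X Y Z : topologicalType) (A : set X) (B : set Y)
    (f : X -> Y) (g : Y -> Z) :
  (forall x, A x -> B (f x)) -> {within A, continuous f} ->
  {within B, continuous g} -> {within A, continuous (g \o f)}.
Proof.
rewrite !subspace_continuousP => fAB cf cg x Ax W /(cg _ (fAB _ Ax)) BW.
have nW : nbhs x (fun z => A z -> B (f z) -> W (g (f z))) := cf _ Ax _ BW.
change (nbhs x (fun z => A z -> W (g (f z)))).
by apply: filterS nW => z fz Az; apply: fz => //; exact: fAB.
Qed.

Lemma within_pair (X Y Z : topologicalType) (A : set X)
    (f : X -> Y) (g : X -> Z) : {within A, continuous f} ->
  {within A, continuous g} -> {within A, continuous (fun x => (f x, g x))}.
Proof.
move=> cf cg x W [[U V] [/= nU nV] UVW].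
have nUV : nbhs (x : subspace A) ((f @^-1` U) `&` (g @^-1` V)).
  by apply: filterI; [exact: cf nU|exact: cg nV].
change (nbhs (x : subspace A) (fun x => W (f x, g x))).
by apply: filterS nUV => z [Uz Vz]; exact: UVW.
Qed.

Lemma within_eq (X Y : topologicalType) (A : set X) (f g : X -> Y) :
  (forall x, A x -> f x = g x) -> {within A, continuous f} ->
  {within A, continuous g}.
Proof.
by move=> fg; apply: subspace_eq_continuous => x /[!inE] Ax; exact: fg.
Qed.

Lemma closed_finite_bigcup (X : topologicalType) (I : Type) (J : set I)
    (A : I -> set X) : finite_set J -> (forall i, J i -> closed (A i)) ->
  closed (\bigcup_(i in J) A i).
Proof.
case/finite_setP => n; elim: n J => [|n IH] J.
  by rewrite II0 card_eq0 => /eqP -> _; rewrite bigcup_set0; exact: closed0.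
case/eq_cardSP => j Jj /IH{}IH clA; rewrite -(setD1K Jj) bigcup_setU1.
by apply: closedU; [exact: clA|apply: IH => i [/clA]].
Qed.

Lemma within_bigcup (X Y : topologicalType) (I : Type) (J : set I)
    (A : I -> set X) (f : X -> Y) : finite_set J ->
  (forall i, J i -> closed (A i)) ->
  (forall i, J i -> {within A i, continuous f}) ->
  {within \bigcup_(i in J) A i, continuous f}.
Proof.
case/finite_setP => n; elim: n J => [|n IH] J.
  rewrite II0 card_eq0 => /eqP -> _ _; rewrite bigcup_set0.
  exact: continuous_subspace0.
case/eq_cardSP => j Jj Jn clA cA; rewrite -(setD1K Jj) bigcup_setU1.
apply: withinU_continuous; first exact: clA.
- apply: closed_finite_bigcup => [|i [/clA]//].
  by apply/finite_setP; exists n.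
- exact: cA.
- by apply: IH => // i [Ji _]; [exact: clA|exact: cA].
Qed.

Lemma within_subtype (X T : topologicalType) (A B : set X) (F : B -> T)
    (f : X -> T) : A `<=` B -> continuous F ->
  (forall u : B, A (\val u) -> f (\val u) = F u) -> {within A, continuous f}.
Proof.
move=> AB cF fF; apply/subspace_continuousP => x Ax W.
pose u : B := exist _ x (mem_set (AB _ Ax)).
have -> : from_subspace A f x = F u by exact: (fF u Ax).
move=> /cF [V [[U oU UV] Vu] VW].
have nU : nbhs x U by apply: open_nbhs_nbhs; split=> //; move: Vu; rewrite -UV.
change (nbhs x (fun z => A z -> W (f z))).
apply: filterS nU => z Uz Az.
pose v : B := exist _ z (mem_set (AB _ Az)).
have -> : f z = F v by exact: (fF v Az).
by apply: VW; rewrite -UV.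
Qed.

Lemma subtype_continuous (X T : topologicalType) (B : set X) (f : X -> T) :
  {within B, continuous f} -> continuous (f \o \val : B -> T).
Proof.
move=> /subspace_continuousP cf u W /(cf _ (set_valP u)) nW.
have {}nW : nbhs (\val u) (fun z => B z -> W (f z)) by [].
have nWu : nbhs u (fun v : B => B (\val v) -> W (f (\val v))) :=
  @initial_continuous B X set_val u _ nW.
change (nbhs u (fun v : B => W (f (\val v)))).
by apply: filterS nWu => v; apply; exact: set_valP.
Qed.

(** * Gluing over the closed cells of a CW complex *)

Definition unit_interval (R : realType) : set R := [set r | 0 <= r <= 1].

Section WeakTopology.
Context {R : realType} {Y : topologicalType} (K : CWcomplex R Y).
Hypothesis compact_cell : forall j, compact (closed_cell (K := K) j).
Local Notation I := (unit_interval (R := R)).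

(** The product with the unit interval also has the weak topology.  Given a
    neighbourhood [W] of [f (x0, r0)] and a compact interval [L] around [r0] with
    [f (x0, r)] in [W] for [r] in [L], the set of [x] for which some [f (x, r)]
    with [r] in [L] escapes [W] is closed: on each closed cell it is the
    projection of a compact set. *)
Lemma cw_within_prod (T : topologicalType) (A : set Y) (f : Y * R -> T) :
  closed A ->
  (forall j, {within (A `&` closed_cell (K := K) j) `*` I, continuous f}) ->
  {within A `*` I, continuous f}.
Proof.
move=> clA cf; apply/subspace_continuousP => -[x0 r0] [/= Ax0 Ir0] W.
rewrite nbhsE => -[U [oU Ux0] UW].
have [j _ jx0] : (\bigcup_i cell (c := K) i) x0 by rewrite cw_cover.
have [e e0 eU] : exists2 e : R, 0 < e &
    forall r, `|r - r0| <= e -> I r -> U (f (x0, r)).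
  have D0 : ((A `&` closed_cell (K := K) j) `*` I) (x0, r0).
    by split=> //; split=> //; exact: subset_closure.
  have nU : nbhs (f (x0, r0)) U by exact: open_nbhs_nbhs.
  have [[/= V1 V2] [/= nV1 /nbhs_ballP[e /= e0 eV2]] V12] : nbhs (x0, r0)
      (fun z => ((A `&` closed_cell (K := K) j) `*` I) z -> U (f z)).
    by have /subspace_continuousP cfj := cf j; exact: cfj nU.
  exists (e / 2) => [|r re Ir]; first by rewrite divr_gt0.
  apply: V12; last by case: D0.
  split; first exact: nbhs_singleton.
  apply: eV2; rewrite /ball /= distrC; apply: le_lt_trans re _.
  by rewrite ltr_pdivrMr // ltr_pMr // ltr1n.
pose L := `[r0 - e, r0 + e]%classic `&` I.
have cL : compact L.
  apply: compact_closedI; first exact: segment_compact.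
  rewrite (_ : I = `[0, 1]%classic); first exact: interval_closed.
  by apply/seteqP; split=> r /=; rewrite in_itv.
pose B := [set x | A x /\ exists2 r, L r & ~ U (f (x, r))].
have clB : closed B.
  apply: (@cw_weak R Y K) => i.
  pose D := (A `&` closure (cell (c := K) i)) `*` L.
  have cD : compact D.
    apply: compact_setX => //; rewrite setIC.
    by apply: compact_closedI => //; exact: compact_cell.
  have /continuous_closedP/(_ (~` U) (open_closedC oU)) :
      {within D, continuous f}.
    by apply: continuous_subspaceW (cf i) => -[x r] [/= ? []].
  move=> /closed_subspaceP[V clV VD].
  have -> : B `&` closure (cell i) = fst @` (D `&` V).
    apply/seteqP; split=> [x [[Ax [r Lr nU]] ix]|_ [[x r] [Dxr Vxr] <-]].
      exists (x, r) => //; rewrite setIC VD.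
      exact: (conj nU (conj (conj Ax ix) Lr)).
    have : (V `&` D) (x, r) by split.
    rewrite VD => -[/= nU [/= [Ax ix] Lr]].
    by split=> //; split=> //; exists r.
  apply: compact_closed; first exact: cw_hausdorff K.
  apply: continuous_compact; last by apply: compact_closedI.
  by apply: continuous_subspaceT => x; exact: cvg_fst.
have nB : nbhs x0 (~` B).
  apply: open_nbhs_nbhs; split; first exact: closed_openC.
  case=> _ [r [/= + Ir]]; rewrite in_itv /= => re; apply; apply: eU => //.
  by rewrite ler_distl.
have nL : nbhs r0 (fun r => `|r - r0| <= e).
  apply/nbhs_ballP; exists e => //= r /ltW.
  by rewrite distrC.
exists (~` B, [set r | `|r - r0| <= e]) => //= -[x r] [/= Bx Lr] [/= Ax Ir].
apply: UW; apply: contrapT => nU; apply: Bx; split=> //; exists r => //.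
by split=> //=; rewrite in_itv /= -ler_distl.
Qed.

Lemma cw_within (T : topologicalType) (A : set Y) (f : Y -> T) : closed A ->
  (forall j, {within A `&` closed_cell (K := K) j, continuous f}) ->
  {within A, continuous f}.
Proof.
move=> clA cf.
have c0 (B : set Y) : {within B, continuous (fun x : Y => (x, 0 : R))}.
  apply: within_pair; apply: continuous_subspaceT => x; first exact: cvg_id.
  exact: cvg_cst.
apply: (within_comp (B := A `*` I) (f := fun x => (x, 0)) (g := f \o fst)) => //.
  by move=> x Ax; split=> //=; rewrite /unit_interval /= lexx ler01.
apply: cw_within_prod => // j.
apply: within_comp (cf j) => [[x r] [] //|].
by apply: continuous_subspaceT => x; exact: cvg_fst.
Qed.

End WeakTopology.
(** * Rays and walls in a compact polyhedron *)

Section Polyhedra.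
Context {R : realType}.

Definition lerp (V : lmodType R) (a b : V) (r : R) : V := (1 - r) *: a + r *: b.

Lemma lerp0 (V : lmodType R) (a b : V) : lerp a b 0 = a.
Proof. by rewrite /lerp subr0 scale1r scale0r addr0. Qed.

Lemma lerp1 (V : lmodType R) (a b : V) : lerp a b 1 = b.
Proof. by rewrite /lerp subrr scale1r scale0r add0r. Qed.

Lemma lerp_mulmx n m (a b : 'rV[R]_n) (M : 'M[R]_(n, m)) r :
  lerp a b r *m M = lerp (a *m M) (b *m M) r.
Proof. by rewrite /lerp mulmxDl !scalemxAl. Qed.

Lemma lerp_coord n m (a b : 'M[R]_(n, m)) r i j :
  lerp a b r i j = (1 - r) * a i j + r * b i j.
Proof. by rewrite !mxE. Qed.

Lemma affine_map_lerp n m (f : 'rV[R]_n -> 'rV[R]_m) a b r : affine_map f ->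
  f (lerp a b r) = lerp (f a) (f b) r.
Proof.
case=> M [c fE]; rewrite !fE lerp_mulmx /lerp !scalerDr addrACA.
by rewrite -scalerDl subrK scale1r.
Qed.

Lemma affine_form_lerp n (f : 'rV[R]_n -> R) a b r : affine_form f ->
  f (lerp a b r) = (1 - r) * f a + r * f b.
Proof. by case=> u [c fE]; rewrite !fE lerp_mulmx lerp_coord; ring. Qed.

Lemma cvg_lerp (T : Type) (F : set_system T) n (f g : T -> 'rV[R]_n)
    (r : T -> R) (a b : 'rV[R]_n) (r0 : R) : Filter F ->
  f @ F --> a -> g @ F --> b -> r @ F --> r0 ->
  lerp (f x) (g x) (r x) @[x --> F] --> lerp a b r0.
Proof.
move=> FF fa gb rr0; apply: cvgD; apply: cvgZ => //.
by apply: (@cvgB R R^o T F FF (fun=> 1) r) => //; exact: cvg_cst.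
Qed.

Lemma cvg_coord (T : Type) (F : set_system T) n (f : T -> 'rV[R]_n)
    (a : 'rV[R]_n) i : Filter F -> f @ F --> a -> f x 0 i @[x --> F] --> a 0 i.
Proof.
by move=> FF fa; exact: (cvg_comp _ _ fa (@coord_continuous R 1 n 0 i a)).
Qed.

Lemma cvg_mulmx_coord (T : Type) (F : set_system T) n k (f : T -> 'rV[R]_n)
    (a : 'rV[R]_n) (M : 'M[R]_(n, k)) i : Filter F -> f @ F --> a ->
  (f x *m M) 0 i @[x --> F] --> (a *m M) 0 i.
Proof.
move=> FF fa; rewrite mxE; under eq_fun do rewrite mxE.
apply: (@cvg_big R^o _ +%R 0 xpredT (@add_continuous R^o)) => j _.
by apply: (@cvgM R); [exact: cvg_coord|exact: cvg_cst].
Qed.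

Lemma face_lerp n (C F : set 'rV[R]_n) a b r : face C F ->
  C (lerp a b r) -> F a -> F b -> F (lerp a b r).
Proof.
case=> _ [u [c [_ ->]]] Cab [_ /= ac] [_ /= bc]; split=> //=.
by rewrite lerp_mulmx lerp_coord ac bc; ring.
Qed.

(** A supporting hyperplane that meets the interior of a segment of [C]
    contains the segment. *)
Lemma face_extremal n (C F : set 'rV[R]_n) a b r : face C F ->
  C a -> C b -> 0 < r < 1 -> F (lerp a b r) -> F a /\ F b.
Proof.
case=> _ [u [c [Cc ->]]] Ca Cb /andP[r0 r1] [_ /=].
rewrite lerp_mulmx lerp_coord => E.
have := Cc _ Ca; have := Cc _ Cb; move: E.
move: ((a *m u) 0 0) ((b *m u) 0 0) => x y E yc xc.
suff [-> ->] : x = c /\ y = c by [].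
have xE : (1 - r) * (c - x) = 0.
  apply/eqP; rewrite eq_le; apply/andP; split; nra.
have yE : r * (c - y) = 0 by nra.
split; nra.
Qed.

Section Poly.
Variables (n k : nat) (C : set 'rV[R]_n) (M : 'M[R]_(n, k)) (b : 'rV[R]_k).
Hypothesis cC : compact C.
Hypothesis CE : C = [set x | forall i, (x *m M) 0 i <= b 0 i].

Lemma poly_lerp x y r : C x -> C y -> 0 <= r <= 1 -> C (lerp x y r).
Proof.
rewrite CE => /= Cx Cy /andP[r0 r1] i; rewrite lerp_mulmx lerp_coord.
by have := Cx i; have := Cy i; nra.
Qed.

(** The points of [C] where the [i]-th inequality is an equality.  It may be all
    of [C], so a wall is a face but not always a proper one. *)
Definition wall i : set 'rV[R]_n := C `&` [set x | (x *m M) 0 i = b 0 i].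

Lemma wall_face i : wall i !=set0 -> face C (wall i).
Proof.
have E x : (x *m col i M) 0 0 = (x *m M) 0 i.
  by rewrite !mxE; apply: eq_bigr => j _; rewrite mxE.
move=> W0; split=> //; exists (col i M), (b 0 i); split=> [x|].
  by rewrite {1}CE E; exact.
by rewrite /wall; congr (_ `&` _); apply/seteqP; split=> x /=; rewrite E.
Qed.

(** A coordinate of a direction in which [C] is unbounded would be unbounded on
    the compact set [C]. *)
Lemma poly_ray x d : (forall r, 0 <= r -> C (x + r *: d)) -> d = 0.
Proof.
move=> Cxd; apply/rowP => j; rewrite mxE; apply: contrapT => /eqP dj.
pose f (y : 'rV[R]_n) := y 0 j * d 0 j.
have [||c _ cmax] := @compact_EVT_max _ _ f C _ cC.
- by exists (x + 0 *: d); exact: Cxd.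
- apply: continuous_subspaceT => y; apply: (@cvgM R _ (nbhs y)); last exact: cvg_cst.
  exact: (@cvg_coord _ (nbhs y) _ id y).
have d2 : 0 < d 0 j ^+ 2 by rewrite exprn_even_gt0.
have Cx : C x by have := Cxd 0 (lexx _); rewrite scale0r addr0.
pose r := (f c - f x + 1) / d 0 j ^+ 2.
have r0 : 0 <= r.
  by rewrite divr_ge0 ?(ltW d2)// addr_ge0 // subr_ge0 cmax // inE.
have := cmax (x + r *: d); rewrite inE => /(_ (Cxd _ r0)).
have -> : f (x + r *: d) = f c + 1.
  rewrite /f !mxE mulrDl -mulrA -expr2 -/(f x) /r divfK ?gt_eqF //.
  by rewrite addrA subrKC.
lra.
Qed.

Definition slack (y : 'rV[R]_n) i := b 0 i - (y *m M) 0 i.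

(** The inverse of the largest factor by which [x - y] can be stretched from [y]
    inside [C].  Inequalities that are tight at [y] put no bound on it. *)
Definition gauge (y x : 'rV[R]_n) : R :=
  \big[Order.max/0]_(i | slack y i != 0) (((x - y) *m M) 0 i / slack y i).

Definition exit (y x : 'rV[R]_n) : 'rV[R]_n := y + (gauge y x)^-1 *: (x - y).

Lemma diff_slack x y i : ((x - y) *m M) 0 i = slack y i - slack x i.
Proof. by rewrite mulmxBl !mxE /slack !mxE; ring. Qed.

Lemma slack_ge0 y i : C y -> 0 <= slack y i.
Proof. by rewrite CE /slack subr_ge0; exact. Qed.

Lemma gauge_gt0 y x : C y -> C x -> x != y -> 0 < gauge y x.
Proof.
move=> Cy Cx; apply: contraNT; rewrite -leNgt => g0.
suff : x - y = 0 by move=> /subr0_eq ->.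
apply: (@poly_ray y) => r r0; rewrite CE /= => i.
rewrite mulmxDl -scalemxAl mxE [X in _ + X]mxE.
have : ((x - y) *m M) 0 i <= 0.
  have [si|si] := eqVneq (slack y i) 0.
    by rewrite diff_slack si sub0r oppr_le0 slack_ge0.
  have sp : 0 < slack y i by rewrite lt_neqAle eq_sym si slack_ge0.
  have := le_trans
    (le_bigmax_cond 0 (fun i => ((x - y) *m M) 0 i / slack y i) si) g0.
  by rewrite ler_pdivrMr // mul0r.
have := slack_ge0 i Cy; rewrite /slack; nra.
Qed.

Lemma gauge_le1 y x : C y -> C x -> gauge y x <= 1.
Proof.
move=> Cy Cx; apply: bigmax_le => // i si.
have sp : 0 < slack y i by rewrite lt_neqAle eq_sym si slack_ge0.
rewrite ler_pdivrMr // mul1r diff_slack.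
by have := slack_ge0 i Cx; lra.
Qed.

Lemma lerp_exit y x : C y -> C x -> x != y ->
  x = lerp y (exit y x) (gauge y x).
Proof.
move=> Cy Cx xy; have g0 := gauge_gt0 Cy Cx xy.
rewrite /lerp /exit scalerDr scalerA divff ?gt_eqF // scale1r addrA.
by rewrite -scalerDl subrK scale1r addrC subrK.
Qed.

Lemma exit_poly y x : C y -> C x -> x != y -> C (exit y x).
Proof.
move=> Cy Cx xy; have g0 := gauge_gt0 Cy Cx xy.
rewrite CE /= => i; rewrite /exit mulmxDl -scalemxAl mxE [X in _ + X]mxE.
rewrite -lerBrDl -/(slack y i) ler_pdivrMl //.
have [si|si] := eqVneq (slack y i) 0.
  by rewrite si mulr0 diff_slack si sub0r oppr_le0 slack_ge0.
have sp : 0 < slack y i by rewrite lt_neqAle eq_sym si slack_ge0.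
by rewrite -ler_pdivrMr //; exact: (le_bigmax_cond _ (fun i => _ / slack y i)).
Qed.

Lemma exit_wall y x : C y -> C x -> x != y ->
  exists i, wall i (exit y x) /\ ~ wall i y.
Proof.
move=> Cy Cx xy; have g0 := gauge_gt0 Cy Cx xy.
apply: contrapT => /forallNP nW; suff : gauge y x < gauge y x by rewrite ltxx.
rewrite {1}/gauge; apply/bigmax_ltP; split=> // i si.
have sp : 0 < slack y i by rewrite lt_neqAle eq_sym si slack_ge0.
rewrite lt_neqAle le_bigmax_cond // andbT; apply/eqP => E.
apply: (nW i); split.
  split; first exact: exit_poly.
  rewrite /= /exit mulmxDl -scalemxAl mxE [X in _ + X]mxE.
  have -> : ((x - y) *m M) 0 i = gauge y x * slack y i by rewrite -E divfK.
  by rewrite mulKf ?gt_eqF // /slack addrC subrK.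
by case=> _ /= yi; move/eqP: si; apply; rewrite /slack yi subrr.
Qed.

Lemma cvg_exit (T : Type) (F : set_system T) y (f : T -> 'rV[R]_n) x :
  Filter F -> C y -> C x -> x != y -> f @ F --> x ->
  exit y (f z) @[z --> F] --> exit y x.
Proof.
move=> FF Cy Cx xy fx.
have cd : (f z - y) @[z --> F] --> x - y.
  by apply: cvgB => //; exact: cvg_cst.
apply: cvgD; first exact: cvg_cst.
apply: cvgZ => //; apply: (@cvgV R); first by rewrite gt_eqF // gauge_gt0.
apply: (@cvg_big R _ _ 0 _ (@max_continuous _ R)) => i si.
by apply: (@cvgM R); [exact: cvg_mulmx_coord|exact: cvg_cst].
Qed.

(** On the affine hull the inequalities that are tight on [C] remain equalities,
    and the others are strict near [u]. *)
Lemma wall_relint u : C u -> (forall i, wall i u -> C `<=` wall i) ->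
  relint C u.
Proof.
move=> Cu uC; split.
  exists 1%N, (fun=> u), (fun=> 1); split=> //; first by rewrite big_ord1.
  by rewrite big_ord1 scale1r.
suff nu : nbhs u (fun x => forall i, aff_hull C x -> (x *m M) 0 i <= b 0 i).
  change (nbhs u (fun x => aff_hull C x -> C x)).
  by apply: filterS nu => x nx ax; rewrite CE => i; exact: nx.
apply: (@filter_forall _ _
  (fun i x => aff_hull C x -> (x *m M) 0 i <= b 0 i)
  (nbhs u) (nbhs_filter u)) => i.
have [ui|ui] := pselect (wall i u).
  apply: nearW => x [m [p [a [Cp a1 ->]]]].
  rewrite mulmx_suml summxE.
  have E j : (a j *: p j *m M) 0 i = a j * b 0 i.
    by rewrite -scalemxAl mxE; have [_ /= ->] := uC _ ui _ (Cp j).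
  by rewrite (eq_bigr _ (fun j _ => E j)) -mulr_suml a1 mul1r.
have ui' : (u *m M) 0 i < b 0 i.
  rewrite lt_neqAle; apply/andP; split; last by move: Cu; rewrite CE; exact.
  by apply/eqP => ui'; apply: ui.
have nu : nbhs u (fun x => (x *m M) 0 i < b 0 i).
  have cu : (x *m M) 0 i @[x --> nbhs u] --> (u *m M) 0 i.
    by apply: (cvg_mulmx_coord (nbhs_filter u)); exact: cvg_id.
  exact: (cvgr_lt _ cu _ ui').
change (nbhs u (fun x => aff_hull C x -> (x *m M) 0 i <= b 0 i)).
by apply: filterS nu => x /ltW.
Qed.

(** Shoot [k + 1] rays from [p] in the directions [e0 + j e1] of two independent
    vectors.  Two of the exit points lie on the same of the [k] walls, and they
    differ because the directions are not proportional. *)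
Lemma two_points_wall d p : has_dim C d -> (1 < d)%N -> relint C p ->
  exists i, ~ wall i p /\ exists z z', [/\ wall i z, wall i z' & z <> z'].
Proof.
move=> [p0 [B [fB aB]]] d1 [ap nC].
have Cp : C p by exact: nbhs_singleton nC ap.
pose e0 : 'rV[R]_d := delta_mx 0 (Ordinal (ltnW d1)).
pose e1 : 'rV[R]_d := delta_mx 0 (Ordinal d1).
pose v (j : 'I_k.+1) := e0 + j%:R *: e1.
have v0 j : v j 0 (Ordinal (ltnW d1)) = 1 by rewrite !mxE /= mulr0 addr0.
have v1 j : v j 0 (Ordinal d1) = j%:R by rewrite !mxE /= add0r mulr1.
have vB0 j : v j *m B != 0.
  apply/eqP => /eqP; rewrite -(mul0mx _ B) (inj_eq (row_free_inj fB)) => /eqP E.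
  by have := v0 j; rewrite E mxE => /eqP; rewrite eq_sym oner_eq0.
have ray j : exists iw : 'I_k * R, 0 < iw.2 /\
    wall iw.1 (p + iw.2 *: (v j *m B)) /\ ~ wall iw.1 p.
  have pr : (p + r *: (v j *m B)) @[r --> (0 : R)] --> p + 0 *: (v j *m B).
    apply: cvgD; first exact: cvg_cst.
    by apply: cvgZ; [exact: cvg_id|exact: cvg_cst].
  rewrite scale0r addr0 in pr.
  have [e /= e0' eC] : exists2 e, 0 < e & C (p + e *: (v j *m B)).
    have /nbhs_ballP[e /= e0' eC] := pr _ nC.
    exists (e / 2); first by rewrite divr_gt0.
    apply: eC; last first.
      move: ap; rewrite aB => -[u _ <-]; exists (u + (e / 2) *: v j) => //.
      by rewrite mulmxDl scalemxAl addrA.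
    rewrite /ball /= sub0r normrN gtr0_norm ?divr_gt0 //.
    by rewrite ltr_pdivrMr // ltr_pMr // ltr1n.
  pose x := p + e *: (v j *m B).
  have xp : x != p.
    rewrite /x -subr_eq0 addrAC subrr add0r scaler_eq0 negb_or vB0.
    by rewrite gt_eqF.
  have [i [wi ni]] := exit_wall Cp eC xp.
  exists (i, (gauge p x)^-1 * e); split=> /=.
    by rewrite mulr_gt0 // invr_gt0 gauge_gt0.
  split=> //; move: wi; rewrite /exit /x (addrAC p) subrr add0r.
  by rewrite scalerA.
have [f fP] := choice ray.
have [j [j' [jj' ff]]] : exists j j', j != j' /\ (f j).1 = (f j').1.
  apply: contrapT => nf; have : injective (fst \o f).
    move=> j j' ff; apply: contrapT => /eqP jj'; apply: nf.
    by exists j, j'.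
  by move=> /leq_card; rewrite !card_ord ltnn.
have [r0 [wj nj]] := fP j; have [r0' [wj' _]] := fP j'.
exists (f j).1; split=> //.
exists (p + (f j).2 *: (v j *m B)), (p + (f j').2 *: (v j' *m B)).
split=> //; first by rewrite ff.
move=> /addrI; rewrite !scalemxAl => /(row_free_inj fB) E.
have := congr1 (fun w : 'rV[R]_d => w 0 (Ordinal (ltnW d1))) E.
have := congr1 (fun w : 'rV[R]_d => w 0 (Ordinal d1)) E.
have sc a (w : 'rV[R]_d) x : (a *: w) 0 x = a * w 0 x by rewrite mxE.
rewrite /= !sc !v0 !v1 !mulr1 => E1 E0.
move: E1; rewrite E0 => /(mulfI (lt0r_neq0 r0'))/eqP.
by rewrite eqr_nat => /eqP/val_inj/eqP; apply/negP.
Qed.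

End Poly.
End Polyhedra.
(** * Charts and faces of cells *)

Section Cells.
Context {R : realType} {G : groupType} {Y : topologicalType}.
Context (K : affineGCW R G Y).
Implicit Types (i j : cell_index K) (x y : Y).
Local Notation I := (unit_interval (R := R)).

Lemma chart_inverse j : exists g : Y -> 'rV[R]_(amb j),
  [/\ forall x, closed_cell j x -> poly (g x) /\ chi (g x) = x,
      forall u, poly u -> g (chi u) = u &
      {within closed_cell j, continuous g}].
Proof.
have [_ _ [[_ _ chi_surj] _ [g [gK cg]]] _] := chi_char j.
exists g; split=> // x /chi_surj[u pu <-].
by rewrite gK.
Qed.

Definition coord j : Y -> 'rV[R]_(amb j) := sval (cid (chart_inverse j)).

Lemma coord_poly j x : closed_cell j x -> poly (coord j x).
Proof. by rewrite /coord; case: cid => /= g [gP _ _] /gP[]. Qed.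

Lemma coordK j x : closed_cell j x -> chi (coord j x) = x.
Proof. by rewrite /coord; case: cid => /= g [gP _ _] /gP[]. Qed.

Lemma chiK j (u : 'rV[R]_(amb j)) : poly u -> coord j (chi u) = u.
Proof. by rewrite /coord; case: cid => /= g [_ gK _] /gK. Qed.

Lemma chart_continuous j : {within closed_cell j, continuous (coord j)}.
Proof. by rewrite /coord; case: cid => /= g []. Qed.

Lemma chi_continuous j : {within poly (i := j), continuous (chi (i := j))}.
Proof. by have [_ _ []] := chi_char j. Qed.

Lemma chi_closed j (u : 'rV[R]_(amb j)) : poly u -> closed_cell j (chi u).
Proof. by have [_ _ [[cf _ _] _ _] _] := chi_char j => /cf. Qed.

Lemma poly_compact j : compact (poly (i := j)).
Proof. by have [[]] := chi_char j. Qed.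

Lemma closed_cellE j : closed_cell j = chi (i := j) @` poly (i := j).
Proof.
apply/seteqP; split=> [x jx|_ [u pu <-]]; last exact: chi_closed.
by exists (coord j x); [exact: coord_poly|exact: coordK].
Qed.

Lemma closed_cell_compact j : compact (closed_cell j).
Proof.
rewrite closed_cellE.
by apply: continuous_compact; [exact: chi_continuous|exact: poly_compact].
Qed.

Lemma closed_cell_closed j : closed (closed_cell j).
Proof. exact: closed_closure. Qed.

Lemma poly_lerpP j (u v : 'rV[R]_(amb j)) r : poly u -> poly v -> I r ->
  poly (lerp u v r).
Proof. by have [[_ [k [M [b CE]]]] _ _ _] := chi_char j; exact: (poly_lerp CE). Qed.

Definition seg j (x y : Y) (r : R) : Y := chi (lerp (coord j x) (coord j y) r).

Lemma seg_closed j x y r : closed_cell j x -> closed_cell j y -> I r ->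
  closed_cell j (seg j x y r).
Proof.
move=> jx jy Ir; apply: chi_closed; apply: poly_lerpP => //; exact: coord_poly.
Qed.

Lemma seg0 j x y : closed_cell j x -> seg j x y 0 = x.
Proof. by move=> jx; rewrite /seg lerp0 coordK. Qed.

Lemma seg1 j x y : closed_cell j y -> seg j x y 1 = y.
Proof. by move=> jy; rewrite /seg lerp1 coordK. Qed.

Lemma seg_continuous (T : topologicalType) (A : set T) j (f g : T -> Y)
    (r : T -> R) : (forall z, A z -> closed_cell j (f z)) ->
  (forall z, A z -> closed_cell j (g z)) -> (forall z, A z -> I (r z)) ->
  {within A, continuous f} -> {within A, continuous g} ->
  {within A, continuous r} ->
  {within A, continuous (fun z => seg j (f z) (g z) (r z))}.
Proof.
move=> Af Ag Ar cf cg cr.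
apply: (within_comp (B := poly (i := j)) (g := chi (i := j))
  (f := fun z => lerp (coord j (f z)) (coord j (g z)) (r z))) => //.
- move=> x Ax; apply: poly_lerpP; last exact: Ar.
  + exact/coord_poly/Af.
  + exact/coord_poly/Ag.
- have cjf := within_comp Af cf (@chart_continuous j).
  have cjg := within_comp Ag cg (@chart_continuous j).
  move=> x; apply: (cvg_lerp (F := nbhs (x : subspace A))).
  + exact: cjf.
  + exact: cjg.
  + exact: cr.
- exact: chi_continuous.
Qed.

(** All that is used of the inclusion of a face: segments drawn in the two charts
    agree, and a segment of [j] that meets [i] in its interior lies in [i].  In
    this form the relation is transitive, and no chart of [i] has to be written
    in terms of a chart of [j]. *)
Definition is_face i j : Prop :=
  [/\ closed_cell i `<=` closed_cell j,
      forall x y r, closed_cell i x -> closed_cell i y -> I r ->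
        seg i x y r = seg j x y r &
      forall x y r, closed_cell j x -> closed_cell j y -> 0 < r < 1 ->
        closed_cell i (seg j x y r) -> closed_cell i x /\ closed_cell i y].

Lemma is_face_refl j : is_face j j.
Proof. by split. Qed.

Lemma is_face_trans i j k : is_face i j -> is_face j k -> is_face i k.
Proof.
move=> [ij1 ij2 ij3] [jk1 jk2 jk3]; split.
- by move=> x /ij1/jk1.
- by move=> x y r ix iy Ir; rewrite ij2 // jk2 //; exact: ij1.
- move=> x y r kx ky r01 ixy.
  have [jx jy] := jk3 x y r kx ky r01 (ij1 _ ixy).
  apply: (ij3 x y r jx jy r01); rewrite jk2 //.
  by case/andP: r01 => /ltW r0 /ltW r1; apply/andP.
Qed.

Lemma face_cell j F : face (poly (i := j)) F ->
  exists i, is_face i j /\ closed_cell i = chi (i := j) @` F.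
Proof.
move=> fF; have [i ij [_ [alpha [aff [[aF ainj asurj] _ _] E]]]] := chi_face fF.
have FC : F `<=` poly (i := j) by case: fF => _ [u [c [_ ->]]] x [].
have iE : closed_cell i = chi (i := j) @` F.
  rewrite closed_cellE; apply/seteqP.
  split=> [_ [v /asurj[u Fu <-] <-]|_ [u Fu <-]].
    by exists u => //; exact: E.
  by exists (alpha u); [exact: aF|rewrite E].
exists i; split=> //; split=> //.
  move=> x y r; rewrite iE => -[u Fu <-] [v Fv <-] Ir.
  have pu := FC _ Fu; have pv := FC _ Fv.
  have Fuv : F (lerp u v r) by apply: (face_lerp fF) => //; exact: poly_lerpP.
  rewrite /seg (chiK pu) (chiK pv) (E _ Fu) (E _ Fv) (E _ Fuv).
  by rewrite (chiK (aF _ Fu)) (chiK (aF _ Fv)) (affine_map_lerp _ _ _ aff).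
move=> x y r jx jy r01; rewrite iE => -[w Fw /(congr1 (coord j))].
have Ir : I r by case/andP: r01 => /ltW r0 /ltW r1; apply/andP.
rewrite chiK; last exact: FC.
rewrite chiK; last by apply: poly_lerpP => //; exact: coord_poly.
move=> wE; move: Fw; rewrite wE.
move=> /(face_extremal fF (coord_poly jx) (coord_poly jy) r01)[Fx Fy].
by split; [exists (coord j x)|exists (coord j y)] => //; exact: coordK.
Qed.

(** By regularity a closed cell is the image of a ball, whose sphere goes to
    finitely many cells of smaller dimension. *)
Lemma closed_cell_ball j : exists J : set (cell_index K),
  [/\ finite_set J, forall i, J i -> (dim i < dim j)%N &
      closed_cell j `<=` cell j `|` \bigcup_(i in J) cell i].
Proof.
have [phi [[_ [[obj _ _] _ _] [J [fJ dJ sJ]]] [[_ _ surj] _ _]]] :=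
  affine_regular j.
exists J; split=> // x /surj[u ub <-].
move: ub; rewrite /unit_ball /= le_eqVlt => /orP[/eqP su|ou].
  by right; apply: sJ; exists u.
by left; apply: obj.
Qed.

Lemma cell_uniq i j x : cell i x -> cell j x -> i = j.
Proof. by move=> ix jx; apply: (cw_disjoint (c := K)); exists x. Qed.

Lemma cell_closed j : cell j `<=` closed_cell j.
Proof. exact: subset_closure. Qed.

Lemma cell_nonempty j : cell j !=set0.
Proof.
have [phi [_ [[obj _ _] _ _] _]] := cw_char j.
exists (phi 0); apply: obj; rewrite /open_unit_ball /= big1 ?ltr01 // => k _.
by rewrite mxE expr0n.
Qed.

Lemma dim_lt i j x : cell i x -> closed_cell j x -> i <> j -> (dim i < dim j)%N.
Proof.
move=> ix jx ij; have [J [_ dJ /(_ _ jx)[/(cell_uniq ix)//|[k Jk kx]]]] :=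
  closed_cell_ball j.
by rewrite (cell_uniq ix kx); exact: dJ.
Qed.

(** If [x] is not in the open cell [j], its chart coordinate lies on a wall that
    is not the whole polyhedron, hence in a closed cell of smaller dimension that
    is a face of [j]; conclude by induction. *)
Lemma carrier_face i j x : cell i x -> closed_cell j x -> is_face i j.
Proof.
have [n] := ubnP (dim j); elim: n j => // n IH j jn ix jx.
have [->|ij] := pselect (i = j); first exact: is_face_refl.
have [[cC [k [M [b CE]]]] _ _ rE] := chi_char j.
pose u := coord j x; have pu : poly u := coord_poly jx.
have [m [mu [w [pw nw]]]] : exists m, wall (poly (i := j)) M b m u /\
    exists w, poly w /\ ~ wall (poly (i := j)) M b m w.
  apply: contrapT => nm; apply: ij; apply: (cell_uniq ix).
  rewrite -rE; exists u; last exact: coordK.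
  apply: (wall_relint CE) => // m mu w pw; apply: contrapT => nw.
  by apply: nm; exists m; split=> //; exists w.
have [i' [i'j i'E]] := face_cell (wall_face CE (ex_intro _ u mu)).
have i'x : closed_cell i' x by rewrite i'E; exists u => //; exact: coordK.
apply: (is_face_trans _ i'j); apply: IH => //.
rewrite -ltnS; apply: leq_trans jn; rewrite ltnS.
have [y i'y] := cell_nonempty i'.
apply: (dim_lt i'y); first by case: i'j => + _ _; apply; exact: cell_closed.
move=> i'jE; have : closed_cell i' (chi w) by rewrite i'jE; exact: chi_closed.
rewrite i'E => -[v mv /(congr1 (coord j))]; rewrite !chiK //; last by case: mv.
by move=> vw; apply: nw; rewrite -vw.
Qed.


(** * Carriers and top vertices *)

Lemma dim0_cell j x y : dim j = 0%N -> closed_cell j x -> closed_cell j y -> x = y.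
Proof.
have [J [_ dJ sJ]] := closed_cell_ball j => dj.
have cj z : closed_cell j z -> cell j z.
  by move=> /sJ[//|[i /dJ]]; rewrite dj.
have [phi [_ [[_ _ surj] _ _] _]] := cw_char j.
move=> /cj/surj[u _ <-] /cj/surj[v _ <-]; congr phi; apply/rowP => k.
by exfalso; case: k => k; rewrite dj.
Qed.

Lemma carrier_exists x : exists i, cell (c := K) i x.
Proof.
have [i _ ix] : (\bigcup_i cell (c := K) i) x by rewrite cw_cover.
by exists i.
Qed.

Definition carrier x : cell_index K := sval (cid (carrier_exists x)).

Lemma carrierP x : cell (carrier x) x.
Proof. by rewrite /carrier; case: cid. Qed.

Lemma carrier_closed x : closed_cell (carrier x) x.
Proof. exact/cell_closed/carrierP. Qed.

Lemma carrier_is_face j x : closed_cell j x -> is_face (carrier x) j.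
Proof. exact/carrier_face/carrierP. Qed.

Lemma dim_carrier j x : closed_cell j x -> carrier x <> j ->
  (dim (carrier x) < dim j)%N.
Proof. exact/dim_lt/carrierP. Qed.

Section Morse.
Variables (h : Y -> R) (hM : is_Gmorse K h).

Lemma morse_seg j x y r : closed_cell j x -> closed_cell j y -> I r ->
  h (seg j x y r) = (1 - r) * h x + r * h y.
Proof.
move=> jx jy Ir; have [f af hf] := morse_affine hM j.
rewrite /seg hf; last by apply: poly_lerpP => //; exact: coord_poly.
by rewrite affine_form_lerp // -!hf ?coordK //; exact: coord_poly.
Qed.

(** A cell of dimension at least 2 on which [h] is constant has a wall with two
    points, which is a cell of smaller positive dimension with the same property;
    so one reaches an edge, where [h] is not constant. *)
Lemma nonconstant_cell j c : (0 < dim j)%N ->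
  exists x, closed_cell j x /\ h x <> c.
Proof.
have [n] := ubnP (dim j); elim: n j => // n IH j jn j0.
apply: contrapT => nx.
have hc x : closed_cell j x -> h x = c.
  by move=> jx; apply: contrapT => hx; apply: nx; exists x.
have [j1|j1] := eqVneq (dim j) 1%N.
  by have [x [y [/hc -> /hc ->]]] := morse_edge hM j1.
have [[cC [k [M [b CE]]]] dC _ rE] := chi_char j.
have [_ [p rp _]] : (chi (i := j) @` relint (poly (i := j))) !=set0.
  by rewrite rE; have [x jx] := cell_nonempty j; exists x.
have d1 : (1 < dim j)%N by rewrite ltn_neqAle eq_sym j1.
have [i [np [z [z' [iz iz' zz']]]]] := two_points_wall cC CE dC d1 rp.
have [i' [i'j i'E]] := face_cell (wall_face CE (ex_intro _ z iz)).
have [x [i'x hx]] : exists x, closed_cell i' x /\ h x <> c.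
  apply: IH; last first.
    rewrite lt0n; apply/eqP => i'0; apply: zz'.
    have := @dim0_cell i' (chi z) (chi z') i'0.
    rewrite i'E => /(_ (ex_intro2 _ _ z iz erefl) (ex_intro2 _ _ z' iz' erefl)).
    by move=> /(congr1 (coord j)); rewrite !chiK //; [case: iz'|case: iz].
  rewrite -ltnS; apply: leq_trans jn; rewrite ltnS.
  have [y i'y] := cell_nonempty i'.
  apply: (dim_lt i'y); first by case: i'j => + _ _; apply; exact: cell_closed.
  have pp : poly p by case: rp => ap /nbhs_singleton; apply.
  move=> i'jE; have : closed_cell i' (chi p) by rewrite i'jE; exact: chi_closed.
  rewrite i'E => -[v mv /(congr1 (coord j))]; rewrite !chiK //; last by case: mv.
  by move=> vp; apply: np; rewrite -vp.
by apply: hx; apply: hc; case: i'j => + _ _; apply.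
Qed.

(** The face of maximal points is a closed cell on which [h] is constant, so its
    dimension is 0. *)
Lemma top_exists j : exists y, [/\ vertex K y, closed_cell j y &
  forall z, closed_cell j z -> z <> y -> h z < h y].
Proof.
have [||x0] :=
  @compact_EVT_max _ _ h (closed_cell j) _ (closed_cell_compact (j := j)).
- by have [x /cell_closed jx] := cell_nonempty j; exists x.
- by apply: continuous_subspaceT; exact: morse_continuous hM.
rewrite inE => jx0 max0; have [f [U [c fE]] hf] := morse_affine hM j.
pose m := (coord j x0 *m U) 0 0.
have hE x : closed_cell j x -> h x = (coord j x *m U) 0 0 + c.
  by move=> jx; rewrite -{1}(coordK jx) hf ?fE //; exact: coord_poly.
pose F := poly (i := j) `&` [set u | (u *m U) 0 0 = m].
have fF : face (poly (i := j)) F.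
  split; first by exists (coord j x0); split=> //; exact: coord_poly.
  exists U, m; split=> // u pu; have := max0 (chi u).
  rewrite inE => /(_ (chi_closed pu)); rewrite !hE ?chiK //; last exact: chi_closed.
  by rewrite lerD2r.
have [i [[ij _ _] iE]] := face_cell fF.
have iF x : closed_cell j x -> closed_cell i x <-> h x = h x0.
  move=> jx; rewrite iE; split=> [[u [pu /= um] <-]|hx].
    by rewrite !hE ?chiK ?um //; exact: chi_closed.
  exists (coord j x); last exact: coordK.
  split; first exact: coord_poly.
  by move: hx; rewrite !hE // => /addIr.
have i0 : dim i = 0%N.
  apply/eqP; rewrite -leqn0 leqNgt; apply/negP => /(nonconstant_cell (h x0)).
  by case=> x [ix]; apply; apply/iF => //; exact: ij.
have [y iy] := cell_nonempty i; have jy : closed_cell j y by exact/ij/cell_closed.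
have hy : h y = h x0 by apply/iF => //; exact: cell_closed.
exists y; split=> //; first by exists i.
move=> z jz zy; rewrite hy lt_neqAle; apply/andP; split; last first.
  by apply: max0; rewrite inE.
apply/eqP => /(iF _ jz) iz; apply: zy.
by apply: dim0_cell iz _ => //; exact: cell_closed.
Qed.

Definition top j : Y := sval (cid (top_exists j)).

Lemma top_closed j : closed_cell j (top j).
Proof. by rewrite /top; case: cid => /= y []. Qed.

Lemma top_is_vertex j : vertex K (top j).
Proof. by rewrite /top; case: cid => /= y []. Qed.

Lemma top_lt j z : closed_cell j z -> z <> top j -> h z < h (top j).
Proof. by rewrite /top; case: cid => /= y [_ _]; apply. Qed.

Lemma top_le j z : closed_cell j z -> h z <= h (top j).
Proof.
by have [-> //|zt /top_lt/(_ zt)/ltW] := pselect (z = top j).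
Qed.

Lemma top_vertexP j y : top_vertex h j y <-> y = top j.
Proof.
split=> [[_ jy ymax]|->]; last first.
  by split; [exact: top_is_vertex|exact: top_closed|exact: top_le].
apply: contrapT => yt; have := top_lt jy yt.
by rewrite ltNge ymax //; exact: top_closed.
Qed.

Lemma top_face i j : is_face i j -> closed_cell i (top j) -> top i = top j.
Proof.
case=> ij _ _ it; apply: contrapT => /(top_lt (ij _ (@top_closed i))).
by rewrite ltNge top_le.
Qed.

Lemma top_face_le i j : is_face i j -> h (top i) <= h (top j).
Proof. by case=> ij _ _; apply: top_le; exact/ij/top_closed. Qed.

(** * Projection away from the top vertex *)

(** The ray from [top j] through [x] leaves [j] at [z].  That [z] is the last
    point of the ray in [j] is expressed by the condition that the carrier of [z]
    does not have [top j] in its closure.  This makes no reference to a chart, so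
    it is inherited by faces and preserved by [G]. *)
Definition exits j x z : Prop :=
  [/\ closed_cell j z, ~ closed_cell (carrier z) (top j) &
      exists2 r, 0 < r <= 1 & x = seg j (top j) z r].

Lemma exits_proj j : exists p : Y -> Y,
  {within closed_cell j `\ top j, continuous p} /\
  forall x, closed_cell j x -> x <> top j -> exits j x (p x).
Proof.
have [[cC [k [M [b CE]]]] _ _ _] := chi_char j.
have pt := coord_poly (@top_closed j).
have xt x : closed_cell j x -> x <> top j -> coord j x != coord j (top j).
  move=> jx nx; apply/eqP => /(congr1 (chi (i := j))).
  by rewrite !coordK //; exact: top_closed.
pose e x := exit M b (coord j (top j)) (coord j x).
exists (chi (i := j) \o e); split.
  apply: (within_comp (B := poly (i := j))).
  - move=> x [jx /= nx]; apply: exit_poly => //; [exact: coord_poly|exact: xt].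
  - apply/subspace_continuousP => x [jx /= nx].
    apply: (cvg_exit cC CE) => //; [exact: coord_poly|exact: xt|].
    have cj : {within closed_cell j `\ top j, continuous (coord j)}.
      by apply: continuous_subspaceW (@chart_continuous j) => ? [].
    by move/subspace_continuousP: cj; apply.
  - exact: chi_continuous.
move=> x jx nx; have px := coord_poly jx; have nx' := xt _ jx nx.
have pe := exit_poly cC CE pt px nx'.
have jz : closed_cell j (chi (e x)) by exact: chi_closed.
split=> //=.
  have [m [wm nm]] := exit_wall cC CE pt px nx'.
  have [i [ij iE]] := face_cell (wall_face CE (ex_intro _ _ wm)).
  have iz : closed_cell i (chi (e x)) by rewrite iE; exists (e x).
  have [ci _ _] := carrier_is_face iz => /ci; rewrite iE => -[u wu ut].
  apply: nm; rewrite -ut chiK //; by case: wu.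
exists (gauge M b (coord j (top j)) (coord j x)).
  by rewrite (gauge_gt0 cC CE) //= (gauge_le1 CE).
by rewrite /seg chiK // -(lerp_exit cC CE) // coordK.
Qed.

Definition proj j : Y -> Y := sval (cid (exits_proj j)).

Lemma proj_continuous j : {within closed_cell j `\ top j, continuous (proj j)}.
Proof. by rewrite /proj; case: cid => /= p []. Qed.

Lemma projP j x : closed_cell j x -> x <> top j -> exits j x (proj j x).
Proof. by rewrite /proj; case: cid => /= p [_]; apply. Qed.

(** If [z'] came strictly before [z] on the ray, it would be interior to the
    segment from [top j] to [z], and its closed carrier would contain [top j]. *)
Lemma exits_uniq j x z z' : exits j x z -> exits j x z' -> z = z'.
Proof.
wlog suff W : z z' / forall r r', r <= r' -> 0 < r <= 1 -> 0 < r' <= 1 ->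
    closed_cell j z -> closed_cell j z' -> ~ closed_cell (carrier z') (top j) ->
    seg j (top j) z r = seg j (top j) z' r' -> z = z'.
  move=> [jz nz [r r01 xr]] [jz' nz' [r' r01' xr']].
  have /orP[rr|rr] := le_total r r'.
    by apply: (W _ _ r r') => //; rewrite -xr.
  by apply/esym/(W _ _ r' r) => //; rewrite -xr'.
move=> r r' rr /andP[r0 r1] /andP[r0' r1'] jz jz' nz' E.
have jt := @top_closed j.
have Ic a : 0 < a -> a <= 1 -> I a by move=> /ltW a0 a1; apply/andP.
have [q [q0 q1 rq]] : exists q, [/\ 0 < q, q <= 1 & r = q * r'].
  exists (r / r'); split; first by rewrite divr_gt0.
    by rewrite ler_pdivrMr // mul1r.
  by rewrite divfK // gt_eqF.
have z'E : z' = seg j (top j) z q.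
  rewrite -[LHS](coordK jz') /seg; congr chi; move: E => /(congr1 (coord j)).
  rewrite !chiK; last 2 first.
  - by apply: poly_lerpP; [exact: coord_poly|exact: coord_poly|exact: Ic].
  - by apply: poly_lerpP; [exact: coord_poly|exact: coord_poly|exact: Ic].
  move=> /rowP E; apply/rowP => k; have := E k; rewrite !lerp_coord rq.
  move: (coord j (top j) 0 k) (coord j z 0 k) (coord j z' 0 k) => a b c.
  by move=> Ek; apply: (mulfI (lt0r_neq0 r0')); lra.
move: q1; rewrite le_eqVlt => /orP[/eqP q1|q1]; first by rewrite z'E q1 seg1.
have [_ _ ext] := carrier_is_face jz'.
case: nz'; apply: (proj1 (ext _ _ q jt jz _ _)); first by rewrite q0.
by rewrite -z'E; exact: carrier_closed.
Qed.

Lemma exits_face i j x z : is_face i j -> closed_cell i (top j) ->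
  exits i x z -> exits j x z.
Proof.
move=> ij it; have [sij segij _] := ij; rewrite /exits (top_face ij it).
move=> [iz nz [r /andP[r0 r1] ->]]; split=> //; first exact: sij.
exists r; first by rewrite r0.
by rewrite segij // /unit_interval /= r1 ltW.
Qed.

(** A face containing [top j] has the same top, so its own projection is the
    restriction of that of [j]. *)
Lemma proj_face i j x : is_face i j -> closed_cell i (top j) ->
  closed_cell i x -> x <> top j -> proj i x = proj j x.
Proof.
move=> ij it ix xt; apply: (@exits_uniq j x).
  by apply: (exits_face ij it); apply: projP => //; rewrite (top_face ij it).
by apply: projP => //; case: ij => + _ _; apply.
Qed.

Lemma proj_id j x : closed_cell j x -> ~ closed_cell (carrier x) (top j) ->
  proj j x = x.
Proof.
move=> jx nx; apply: (@exits_uniq j x).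
  by apply: projP => // xt; apply: nx; rewrite -xt; exact: carrier_closed.
by split=> //; exists 1; [rewrite ltr01 lexx|rewrite seg1].
Qed.

Lemma proj_closed j x : closed_cell j x -> x <> top j -> closed_cell j (proj j x).
Proof. by move=> jx xt; have [] := projP jx xt. Qed.

Lemma carrier_proj j x : closed_cell j x -> x <> top j -> carrier (proj j x) <> j.
Proof.
move=> jx xt; have [_ nt _] := projP jx xt => E.
by apply: nt; rewrite E; exact: top_closed.
Qed.

Lemma proj_le j x : closed_cell j x -> x <> top j -> h (proj j x) <= h x.
Proof.
move=> jx xt; have [jz _ [r /andP[r0 r1] xE]] := projP jx xt.
have Ir : I r by rewrite /unit_interval /= r1 ltW.
rewrite {2}xE morse_seg //; last exact: top_closed.
by have := top_le jz; nra.
Qed.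

(** * The retraction and the sliding homotopy *)

Section Retraction.
Variable s : R.
Local Notation A := (sublevel h s).

Definition step x : Y :=
  if s < h (top (carrier x)) then proj (carrier x) x else x.

(** Each effective step lowers the dimension of the carrier, so this many steps
    suffice to reach a fixed point ([iter_step]). *)
Definition retr x : Y := iter (dim (carrier x)) step x.

Lemma not_top j x : A x -> s < h (top j) -> x <> top j.
Proof. by move=> /= hx sj xt; move: sj; rewrite -xt ltNge hx. Qed.

Lemma step_closed x : A x -> closed_cell (carrier x) (step x).
Proof.
move=> Ax; rewrite /step; case: ifP => sx; last exact: carrier_closed.
by apply: proj_closed; [exact: carrier_closed|exact: not_top].
Qed.

Lemma step_sublevel x : A x -> A (step x).
Proof.
move=> Ax; rewrite /step; case: ifP => // sx; apply: (le_trans _ Ax).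
by apply: proj_le; [exact: carrier_closed|exact: not_top].
Qed.

Lemma dim_step x : A x -> s < h (top (carrier x)) ->
  (dim (carrier (step x)) < dim (carrier x))%N.
Proof.
move=> Ax sx; apply: dim_carrier; first exact: step_closed.
rewrite /step sx; apply: carrier_proj; first exact: carrier_closed.
exact: not_top.
Qed.

Lemma iter_step_low n x : ~~ (s < h (top (carrier x))) -> iter n step x = x.
Proof.
move=> /negPf sx; have sE : step x = x by rewrite /step sx.
by elim: n => //= n ->.
Qed.

Lemma iter_step n x : A x -> (dim (carrier x) <= n)%N -> iter n step x = retr x.
Proof.
elim/ltn_ind: n x => n IH x Ax xn; rewrite /retr.
have [sx|/iter_step_low sx] := boolP (s < h (top (carrier x))); last by rewrite !sx.
have dx := dim_step Ax sx.
case: n => [|n] in IH xn *; first by have := leq_trans dx xn.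
case xE : (dim (carrier x)) dx xn => [//|d]; rewrite !ltnS => dx dn.
rewrite !iterSr !IH //; try exact: step_sublevel.
by apply: leq_trans dn.
Qed.

Lemma retr_low x : h (top (carrier x)) <= s -> retr x = x.
Proof. by rewrite leNgt; exact: iter_step_low. Qed.

Lemma retr_proj x : A x -> s < h (top (carrier x)) ->
  retr x = retr (proj (carrier x) x).
Proof.
move=> Ax sx; have dx := dim_step Ax sx.
rewrite -(iter_step Ax (leqnSn _)) iterSr iter_step; last 2 first.
- exact: step_sublevel.
- exact: ltnW.
by rewrite /step sx.
Qed.

Lemma retr_ind (P : Y -> Prop) :
  (forall x, A x -> h (top (carrier x)) <= s -> P x) ->
  (forall x, A x -> s < h (top (carrier x)) -> A (proj (carrier x) x) ->
     P (proj (carrier x) x) -> P x) ->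
  forall x, A x -> P x.
Proof.
move=> Plow Pstep x; have [n] := ubnP (dim (carrier x)).
elim: n x => // n IH x xn Ax.
have [hx|sx] := leP (h (top (carrier x))) s; first exact: Plow.
have dx := dim_step Ax sx; have := step_sublevel Ax; rewrite /step sx => Apx.
apply: Pstep => //; apply: IH => //.
by move: dx; rewrite /step sx => dx; apply: leq_trans dx _; rewrite -ltnS.
Qed.

Lemma retr_closed x : A x -> closed_cell (carrier x) (retr x).
Proof.
move: x; apply: retr_ind => x Ax sx.
  by rewrite retr_low //; exact: carrier_closed.
move=> Apx IH; rewrite retr_proj //.
have [] := carrier_is_face (proj_closed (@carrier_closed x) (not_top Ax sx)).
by move=> + _ _; apply.
Qed.

Lemma retr_le x : A x -> h (retr x) <= h x.
Proof.
move: x; apply: retr_ind => x Ax sx; first by rewrite retr_low.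
move=> Apx IH; rewrite retr_proj //; apply: le_trans IH _.
by apply: proj_le; [exact: carrier_closed|exact: not_top].
Qed.

Lemma retr_top x : A x -> h (top (carrier (retr x))) <= s.
Proof.
move: x; apply: retr_ind => x Ax sx; first by rewrite retr_low.
by move=> Apx IH; rewrite retr_proj.
Qed.

Lemma sublevel_closed r : closed (sublevel h r).
Proof.
rewrite (_ : sublevel h r = h @^-1` [set y | y <= r]) //.
apply: preimage_closed; last exact: closed_le.
by move=> x _; exact: (morse_continuous hM).
Qed.

Lemma carrier_top_le j x : closed_cell j x -> h (top (carrier x)) <= h (top j).
Proof. by move=> /carrier_is_face/top_face_le. Qed.

(** If the closed carrier of [x] contains [top j], both project from the same
    vertex; otherwise [proj j] fixes [x]. *)
Lemma retr_proj_closed j x : A x -> closed_cell j x -> s < h (top j) ->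
  retr x = retr (proj j x).
Proof.
move=> Ax jx sj.
have [ct|nt] := pselect (closed_cell (carrier x) (top j)); last by rewrite proj_id.
have cj := carrier_is_face jx; have tE := top_face cj ct.
rewrite retr_proj //; last by rewrite tE.
congr retr; apply: proj_face => //; [exact: carrier_closed|exact: not_top].
Qed.

(** When [top j] is above [s], [retr] factors on [j] through [proj j] and the
    finite union of the smaller cells that cover the boundary. *)
Lemma retr_continuous_cell j : {within A `&` closed_cell j, continuous retr}.
Proof.
have [n] := ubnP (dim j); elim: n j => // n IH j jn.
have [js|sj] := leP (h (top j)) s.
  apply: (@within_eq _ _ _ id); last first.
    by apply: continuous_subspaceT => x; exact: cvg_id.
  move=> x [_ jx]; rewrite retr_low //; apply: le_trans js.
  exact: carrier_top_le.
have [J [fJ dJ sJ]] := closed_cell_ball j.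
apply: (@within_eq _ _ _ (retr \o proj j)).
  by move=> x [Ax jx]; rewrite /= -retr_proj_closed.
apply: (within_comp (B := \bigcup_(i in J) (A `&` closed_cell i))).
- move=> x [Ax jx]; have xt := not_top Ax sj.
  have jp := proj_closed jx xt.
  have [jp'|[i Ji ip]] := sJ _ jp.
    by case: (carrier_proj jx xt); apply: cell_uniq jp'; exact: carrierP.
  exists i => //; split; last exact: cell_closed.
  by apply: le_trans Ax; exact: proj_le.
- apply: continuous_subspaceW (@proj_continuous j) => x [Ax jx]; split=> //.
  exact: not_top.
- apply: within_bigcup => // i Ji.
    by apply: closedI; [exact: sublevel_closed|exact: closed_cell_closed].
  by apply: IH; apply: leq_trans (dJ _ Ji) _; rewrite -ltnS.
Qed.

(** The straight-line homotopy, which runs from [retr] at time 0 to the identity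
    at time 1. *)
Definition slide (xr : Y * R) : Y := seg (carrier xr.1) (retr xr.1) xr.1 xr.2.

Lemma slide_cell j x r : A x -> I r -> closed_cell j x ->
  slide (x, r) = seg j (retr x) x r.
Proof.
move=> Ax Ir jx; have [_ segE _] := carrier_is_face jx.
by apply: segE => //; [exact: retr_closed|exact: carrier_closed].
Qed.

Lemma slide_carrier x r : A x -> I r -> closed_cell (carrier x) (slide (x, r)).
Proof.
by move=> Ax Ir; apply: seg_closed => //; [exact: retr_closed|exact: carrier_closed].
Qed.

Lemma slide_closed j x r : A x -> I r -> closed_cell j x ->
  closed_cell j (slide (x, r)).
Proof.
move=> Ax Ir jx; have [+ _ _] := carrier_is_face jx; apply.
exact: slide_carrier.
Qed.

Lemma slide0 x : A x -> slide (x, 0) = retr x.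
Proof. by move=> Ax; apply: seg0; exact: retr_closed. Qed.

Lemma slide1 x : slide (x, 1) = x.
Proof. by apply: seg1; exact: carrier_closed. Qed.

Lemma slide_le x r : A x -> I r -> h (slide (x, r)) <= h x.
Proof.
move=> Ax Ir; rewrite /slide morse_seg //=; last 2 first.
- exact: retr_closed.
- exact: carrier_closed.
by have := retr_le Ax; case/andP: Ir => r0 r1; nra.
Qed.

Lemma slide_continuous_cell j :
  {within (A `&` closed_cell j) `*` I, continuous slide}.
Proof.
pose B := (A `&` closed_cell j) `*` I.
have c1 : {within B, continuous (@fst Y R)}.
  by apply: continuous_subspaceT => x; exact: cvg_fst.
have c2 : {within B, continuous (@snd Y R)}.
  by apply: continuous_subspaceT => x; exact: cvg_snd.
apply: (@within_eq _ _ _ (fun z : Y * R => seg j (retr z.1) z.1 z.2)).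
  by move=> [x r] [[/= Ax jx] Ir]; rewrite (slide_cell Ax Ir jx).
apply: seg_continuous => //.
- move=> [x r] [[/= Ax jx] _]; have [+ _ _] := carrier_is_face jx; apply.
  exact: retr_closed.
- by move=> [x r] [[]].
- by move=> [x r] [].
- by apply: within_comp (@retr_continuous_cell j) => // -[x r] [].
Qed.

(** * Equivariance *)

Section Equivariance.
Variable g : G.
Local Notation a := (act K).

Lemma act_cell i : exists j, a g @` cell i = cell j.
Proof. by have [_ + _] := affine_GCW K; apply. Qed.

Lemma act_carrier x : a g @` cell (carrier x) = cell (carrier (a g x)).
Proof.
have [j gj] := act_cell (carrier x).
rewrite gj; congr cell; apply: (@cell_uniq _ _ (a g x)); last exact: carrierP.
by rewrite -gj; exists x => //; exact: carrierP.
Qed.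

Lemma act_cellV (f : G) i j : a f @` cell i = cell j -> a f^-1%g @` cell j = cell i.
Proof.
move=> <-; apply/seteqP; split=> [_ [_ [x ix <-] <-]|x ix].
  by rewrite actKV.
by exists (a f x); [exists x|rewrite actKV].
Qed.

Lemma act_top i j : a g @` cell i = cell j -> top j = a g (top i).
Proof.
move=> gij; apply/esym/top_vertexP/(top_vertex_act hM gij); exact/top_vertexP.
Qed.

Lemma act_seg i j x y r : a g @` cell i = cell j -> closed_cell i x ->
  closed_cell i y -> I r -> a g (seg i x y r) = seg j (a g x) (a g y) r.
Proof.
move=> gij ix iy Ir; have [_ [alpha [aff [[af _ _] _ _] E]]] := chi_act gij.
have px := coord_poly ix; have py := coord_poly iy.
have e u : poly u -> a g (chi u) = chi (alpha u) by exact: E.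
rewrite -{2}(coordK ix) -{2}(coordK iy) /seg !e //; last exact: poly_lerpP.
by rewrite !chiK ?affine_map_lerp //; exact: af.
Qed.

Lemma act_exits i j x z : a g @` cell i = cell j -> exits i x z ->
  exits j (a g x) (a g z).
Proof.
move=> gij [iz nz [r r01 xE]]; split.
- exact: closed_cell_act gij iz.
- rewrite (act_top gij) => /(closed_cell_act (act_cellV (act_carrier z))).
  by rewrite actKV.
- exists r => //; rewrite (act_top gij) -(act_seg gij) -?xE //.
    exact: top_closed.
  by case/andP: r01 => /ltW r0 r1; apply/andP.
Qed.

Lemma act_proj i j x : a g @` cell i = cell j -> closed_cell i x ->
  x <> top i -> proj j (a g x) = a g (proj i x).
Proof.
move=> gij ix xt; apply: (@exits_uniq j (a g x)).
  apply: projP; first exact: closed_cell_act gij ix.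
  rewrite (act_top gij) => /(congr1 (a g^-1%g)).
  by rewrite !actKV.
by apply: act_exits gij _; exact: projP.
Qed.

Lemma act_sublevel x : A x -> A (a g x).
Proof. exact: sublevel_actP. Qed.

Lemma act_retr x : A x -> retr (a g x) = a g (retr x).
Proof.
have tE z : h (top (carrier (a g z))) = h (top (carrier z)).
  by rewrite (act_top (act_carrier z)) (morse_act hM).
move: x; apply: retr_ind => x Ax sx; first by rewrite !retr_low // tE.
move=> Apx IH; rewrite (retr_proj Ax) // retr_proj; last 2 first.
- exact: act_sublevel.
- by rewrite tE.
rewrite (act_proj (act_carrier x)) //; [exact: carrier_closed|exact: not_top].
Qed.

Lemma act_slide x r : A x -> I r -> slide (a g x, r) = a g (slide (x, r)).
Proof.
move=> Ax Ir; rewrite /slide /= act_retr // (act_seg (act_carrier x)) //.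
  exact: retr_closed.
exact: carrier_closed.
Qed.

End Equivariance.
End Retraction.
End Morse.
End Cells.
Lemma within_into_subtype (X Y : topologicalType) (A : set X) (B : set Y)
    (f : X -> B) :
  {within A, continuous (fun x => \val (f x))} -> {within A, continuous f}.
Proof.
by move=> cf; apply: (@continuous_comp_initial _ (subspace A) Y (set_val : B -> Y)).
Qed.

Lemma empty_equivalence (R : realType) (G : groupType) (X Z : topologicalType)
    (a : G -> X -> X) (b : G -> Z -> Z) (f : X -> Z) : G_map a b f ->
  (X -> False) -> (Z -> False) -> G_homotopy_equivalence R a b f.
Proof.
move=> fG nX nZ; split=> //; exists (fun z => False_rect X (nZ z)).
split; first by split=> [z|g z]; have := nZ z.
- exists (fun xr => False_rect X (nX xr.1)).
  by split=> [[x r]|g x|x|x]; have := nX x.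
- exists (fun zr => False_rect Z (nZ zr.1)).
  by split=> [[x r]|g x|x|x]; have := nZ x.
Qed.

(** * The natural map and its inverse *)

Section NaturalMap.
Context {R : realType} {G : groupType} {Y : topologicalType}.
Context (K : affineGCW R G Y) (h : Y -> R) (hM : is_Gmorse K h).
Context (t s : R) (lt_ts : t < s).
Hypothesis no_vertex : forall y, vertex K y -> ~ (t < h y < s).
Local Notation ts := (ltW lt_ts).
Local Notation P := (morse_pushout K h ts).
Local Notation nat_map := (natural_map K h ts).
Local Notation from_star :=
  (pushout_inl (links_stars ts) (@Phi R G Y K h t s)).
Local Notation from_low :=
  (pushout_inr (links_stars ts) (@Phi R G Y K h t s)).
Local Notation I := (unit_interval (R := R)).
Local Notation A := (sublevel h s).

Lemma top_height j : t < h (top hM j) -> h (top hM j) <= s -> h (top hM j) = s.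
Proof.
move=> tj js; apply/eqP; rewrite eq_le js leNgt /=; apply/negP => sj.
by apply: (no_vertex (top_is_vertex hM j)); rewrite tj.
Qed.

(** The carrier of [x] is a face of a cell with top [y].  Its top is above [t],
    hence at height [s], and [y] is the only point of that cell so high. *)
Lemma star_top y x : vertices_at K h s y -> desc_star K h t s y x ->
  t < h x -> top hM (carrier K x) = y.
Proof.
move=> [_ hy] [[i /(top_vertexP hM) yE ix] _] tx; rewrite yE.
have ci := carrier_is_face ix.
have h1 : t < h (top hM (carrier K x)).
  by apply: lt_le_trans tx _; apply: top_le; exact: carrier_closed.
have h2 : h (top hM (carrier K x)) <= s.
  by rewrite -hy yE; exact: top_face_le.
apply: contrapT => /(top_lt (j := i)); rewrite top_height // -yE hy ltxx => E.
by have : false by apply: E; case: ci => + _ _; apply; exact: top_closed.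
Qed.

(** A point of a descending star at height at most [t] is in the descending link,
    where it is glued to the sublevel set. *)
Lemma low_from_low p : h (\val (nat_map p)) <= t -> exists x, p = from_low x.
Proof.
move: p; apply: pushout_ind => [[y x]|x _]; last by exists x.
rewrite natural_map_star /= => hx.
have [yx /= /andP[tx _]] := set_valP x.
have lx : desc_link K h t (\val y) (\val x).
  by split=> //; apply/eqP; rewrite eq_le hx.
pose a : links K h t s := existT _ y (exist _ (\val x) (mem_set lx)).
exists (Phi a); rewrite -pushout_comm; congr pushout_inl.
by apply: coprod_eq.
Qed.

Lemma val_from_low x : \val (nat_map (from_low x)) = \val x.
Proof. by rewrite natural_map_sublevel. Qed.

Lemma high_from_star p : t < h (\val (nat_map p)) ->
  exists x, p = from_star x.
Proof.
move: p; apply: pushout_ind => x; first by exists x.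
by rewrite val_from_low ltNge (set_valP x).
Qed.

(** Above [t] a point of the pushout is in a star, and its vertex is recovered as
    the top of its carrier. *)
Lemma natural_map_inj p p' : \val (nat_map p) = \val (nat_map p') -> p = p'.
Proof.
move=> E; have [hx|hx] := leP (h (\val (nat_map p))) t.
  have [x px] := low_from_low hx; move: hx; rewrite E => /low_from_low[x' px'].
  by move: E; rewrite px px' !val_from_low => /val_inj ->.
have [[y x] px] := high_from_star hx.
have [[y' x'] px'] : exists x', p' = from_star x'.
  by apply: high_from_star; rewrite -E.
move: E hx; rewrite px px' !natural_map_star => E hx.
have xE : set_val x = set_val x' := E.
have {}hx : t < h (set_val x) := hx.
congr pushout_inl; apply: coprod_eq => //; apply: val_inj.
have dx' : desc_star K h t s (\val y') (set_val x).
  by rewrite xE; exact: set_valP.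
exact: etrans (esym (star_top (set_valP y) (set_valP x) hx))
  (star_top (set_valP y') dx' hx).
Qed.

(** The image of the natural map ([image_natural_map], [image_onto]). *)
Definition image_set : set Y :=
  [set x | h x <= t \/ h (top hM (carrier K x)) <= s].
Local Notation Z := image_set.

Lemma image_sublevel : Z `<=` A.
Proof.
move=> x [/= xt|xs]; first by apply: le_trans xt ts.
by apply: le_trans xs; apply: top_le; exact: carrier_closed.
Qed.

Lemma image_natural_map p : Z (\val (nat_map p)).
Proof.
move: p; apply: pushout_ind => [[y x]|x]; last first.
  by left; rewrite val_from_low; exact: (set_valP x).
right; rewrite natural_map_star /=.
have [[i /(top_vertexP hM) yE ix] _] := set_valP x.
apply: le_trans (carrier_top_le hM ix) _; rewrite -yE.
by have [_ ->] := set_valP y.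
Qed.

Lemma image_onto x : Z x -> exists p, \val (nat_map p) = x.
Proof.
move=> Zx; have [xt|tx] := leP (h x) t.
  exists (from_low (exist _ x (mem_set (xt : sublevel h t x)))).
  by rewrite val_from_low.
case: Zx => [|xs]; first by rewrite leNgt tx.
have jx := @carrier_closed _ _ _ K x.
have tj := lt_le_trans tx (top_le hM jx).
pose y := top hM (carrier K x).
have vy : vertices_at K h s y by split; [exact: top_is_vertex|exact: top_height].
have yx : desc_star K h t s y x.
  split; first by exists (carrier K x) => //; exact/(top_vertexP hM).
  by rewrite /= (ltW tx) (le_trans (top_le hM jx)).
exists (from_star (existT _ (exist _ y (mem_set vy)) (exist _ x (mem_set yx)))).
by rewrite natural_map_star.
Qed.

Section Faces.
Variable j : cell_index K.

Definition top_faces : set (cell_index K) :=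
  [set i | is_face i j /\ h (top hM i) = s].

Lemma top_faces_finite : finite_set top_faces.
Proof.
have [J [fJ _ sJ]] := closed_cell_ball j.
apply: (@sub_finite_set _ _ ([set j] `|` J)).
  move=> i [[ij _ _] _]; have [x ix] := cell_nonempty i.
  have [jx|[k Jk kx]] := sJ _ (ij _ (cell_closed ix)).
    by left; exact: cell_uniq ix jx.
  by right; rewrite (cell_uniq ix kx).
by rewrite finite_setU; split=> //; exact: finite_set1.
Qed.

(** A finite closed cover of the image in a closed cell, by pieces on which the
    inverse of the natural map is one of the two structural maps. *)
Lemma image_cell : Z `&` closed_cell j = (sublevel h t `&` closed_cell j) `|`
  \bigcup_(i in top_faces) (closed_cell i `&` [set x | t <= h x]).
Proof.
apply/seteqP; split=> [x [Zx jx]|x [[xt jx]|[i [[ij _ _] hi] [ix _]]]]; last 2 first.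
- by split=> //; left.
- split; last exact: ij.
  by right; rewrite -hi; exact: carrier_top_le.
have [xt|tx] := leP (h x) t; first by left.
case: Zx => [|xs]; first by rewrite leNgt tx.
have cx := @carrier_closed _ _ _ K x.
right; exists (carrier K x); last by split=> //=; exact: ltW.
split; first exact: carrier_is_face.
apply: top_height => //; exact: lt_le_trans tx (top_le hM cx).
Qed.

Lemma superlevel_closed : closed [set x | t <= h x].
Proof.
rewrite (_ : [set x | t <= h x] = h @^-1` [set y | t <= y]) //.
apply: preimage_closed; last exact: closed_ge.
by move=> x _; exact: (morse_continuous hM).
Qed.

Lemma low_cell_closed : closed (sublevel h t `&` closed_cell j).
Proof.
by apply: closedI; [exact: (sublevel_closed hM)|exact: closed_cell_closed].
Qed.

Lemma star_cell_closed (i : cell_index K) :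
  closed (closed_cell i `&` [set x | t <= h x]).
Proof.
by apply: closedI; [exact: closed_cell_closed|exact: superlevel_closed].
Qed.

Lemma image_cell_closed : closed (Z `&` closed_cell j).
Proof.
rewrite image_cell; apply: closedU; first exact: low_cell_closed.
apply: closed_finite_bigcup => [|i _]; first exact: top_faces_finite.
exact: star_cell_closed.
Qed.

End Faces.

Lemma image_closed : closed Z.
Proof. by apply: (@cw_weak R Y K) => j; exact: image_cell_closed. Qed.

Section Inverse.
Variable p0 : P.

(** Off the image the value [p0] is a placeholder. *)
Definition inverse (x : Y) : P :=
  if pselect (exists p, \val (nat_map p) = x) is left e
  then sval (cid e) else p0.

Lemma inverseP x : Z x -> \val (nat_map (inverse x)) = x.
Proof.
rewrite /inverse => /image_onto Zx; case: pselect => // e.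
by case: cid.
Qed.

Lemma inverseK p : inverse (\val (nat_map p)) = p.
Proof. by apply: natural_map_inj; rewrite inverseP //; exact: image_natural_map. Qed.

Lemma inverse_continuous (j : cell_index K) :
  {within Z `&` closed_cell j, continuous inverse}.
Proof.
rewrite image_cell; apply: withinU_continuous.
- exact: low_cell_closed.
- apply: closed_finite_bigcup => [|i _]; first exact: top_faces_finite.
  exact: star_cell_closed.
- apply: (@within_subtype _ _ _ (sublevel h t) from_low) => [x []//||u _].
    exact: pushout_inr_continuous.
  by rewrite -val_from_low inverseK.
- apply: within_bigcup => [|i _|i [ij hi]]; first exact: top_faces_finite.
    exact: star_cell_closed.
  pose y := top hM i.
  have vy : vertices_at K h s y by split; [exact: top_is_vertex|].
  pose yv : vertices_at K h s := exist _ y (mem_set vy).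
  apply: (@within_subtype _ _ _ (desc_star K h t s y)
    (fun x => from_star (existT
      (fun z : vertices_at K h s => desc_star K h t s (\val z)) yv x))).
  + move=> x [ix /= tx]; split; first by exists i => //; exact/(top_vertexP hM).
    by rewrite /= tx -hi top_le.
  + move=> x; apply: (@continuous_comp _ (stars K h t s)).
      exact: existT_continuous.
    exact: pushout_inl_continuous.
  + by move=> u _; rewrite -[RHS]inverseK natural_map_star.
Qed.

Lemma slide_image x r : Z x -> I r -> Z (slide hM s (x, r)).
Proof.
move=> Zx Ir; have Ax := image_sublevel Zx; case: Zx => [xt|xs]; [left|right].
  by apply: le_trans xt; exact: slide_le.
by apply: le_trans xs; apply: carrier_top_le; exact: slide_carrier.
Qed.

Lemma inverse_slide_continuous :
  {within Z `*` I, continuous (inverse \o slide hM s)}.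
Proof.
apply: (cw_within_prod (@closed_cell_compact _ _ _ K) image_closed) => j.
apply: within_comp (@inverse_continuous j).
  move=> [x r] [[/= Zx jx] Ir]; split; first exact: slide_image.
  by apply: slide_closed => //; exact: image_sublevel.
apply: continuous_subspaceW (slide_continuous_cell (hM := hM) (s := s) (j := j)).
by move=> [x r] [[/= /image_sublevel Ax jx] Ir].
Qed.

Lemma retr_image x : A x -> Z (retr hM s x).
Proof. by move=> Ax; right; exact: retr_top. Qed.

Lemma inverse_retr_continuous : {within A, continuous (inverse \o retr hM s)}.
Proof.
apply: (cw_within (@closed_cell_compact _ _ _ K)); first exact: (sublevel_closed hM).
move=> j; apply: within_comp (@inverse_continuous j); last first.
  exact: retr_continuous_cell.
move=> x [Ax jx]; split; first exact: retr_image.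
by have [+ _ _] := carrier_is_face jx; apply; exact: retr_closed.
Qed.

Lemma natural_map_act g p : nat_map (morse_pushout_act hM ts g p) =
  sublevel_act hM s g (nat_map p).
Proof.
have E a : (from_star \o stars_act hM g) (links_stars ts a) =
    (from_low \o sublevel_act hM t g) (Phi a).
  have -> : (from_low \o sublevel_act hM t g) (Phi a) =
      from_low (Phi (links_act hM g a)) by congr pushout_inr; exact: val_inj.
  by rewrite -pushout_comm /=; congr pushout_inl; apply: coprod_eq.
move: p; apply: pushout_ind => x; apply: val_inj.
  all: rewrite /morse_pushout_act /pushout_act.
  by rewrite (pushout_map_inl E) /= !natural_map_star.
by rewrite (pushout_map_inr E) /= !natural_map_sublevel.
Qed.

Lemma natural_map_continuous : continuous nat_map.
Proof.
apply: pushout_map_continuous; first exact: Psi_Phi.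
  move=> [y x].
  apply: (@continuous_comp_initial _ (stars K h t s) Y (set_val : A -> Y)).
  move=> [y' x'] U nU.
  exact: (@initial_continuous (desc_star K h t s (\val y')) Y set_val x' _ nU).
apply: (@continuous_comp_initial _ (sublevel h t) Y (set_val : A -> Y)).
exact: (@initial_continuous (sublevel h t) Y set_val).
Qed.

Lemma val_natural_map_continuous : continuous (fun p => \val (nat_map p)).
Proof.
move=> p; apply: (@continuous_comp _ A Y nat_map set_val).
  exact: natural_map_continuous.
exact: (@initial_continuous A Y set_val).
Qed.

Lemma act_inverse g x : Z x -> Z (act K g x) ->
  inverse (act K g x) = morse_pushout_act hM ts g (inverse x).
Proof.
move=> Zx Zgx; apply: natural_map_inj.
by rewrite inverseP // natural_map_act /= inverseP.
Qed.

Lemma pushout_equivalence : G_homotopy_equivalence R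
  (morse_pushout_act hM ts) (sublevel_act hM s) nat_map.
Proof.
have I0 : I 0 by rewrite /unit_interval /= lexx ler01.
split; first by split; [exact: natural_map_continuous|exact: natural_map_act].
pose k (x : A) := inverse (retr hM s (\val x)).
have kE x : \val (nat_map (k x)) = retr hM s (\val x).
  by rewrite inverseP //; apply: retr_image; exact: set_valP.
exists k; split.
- split; first exact: (subtype_continuous inverse_retr_continuous).
  move=> g x; apply: natural_map_inj; rewrite natural_map_act /= !kE /=.
  by apply: act_retr; exact: set_valP.
- exists (fun pr => inverse (slide hM s (\val (nat_map pr.1), pr.2))); split.
  + apply: within_comp inverse_slide_continuous.
      by move=> [p r] [_ Ir]; split=> //; exact: image_natural_map.
    apply: (within_pair (f := (fun p => \val (nat_map p)) \o fst) (g := snd)).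
      apply: continuous_subspaceT => z.
      apply: (@continuous_comp _ P Y fst); first exact: cvg_fst.
      exact: val_natural_map_continuous.
    by apply: continuous_subspaceT => z; exact: cvg_snd.
  + move=> g p r Ir; rewrite natural_map_act /=.
    have Zp := image_natural_map p; have Ap := image_sublevel Zp.
    rewrite act_slide //; apply: act_inverse; first exact: slide_image.
    rewrite -act_slide //; apply: slide_image => //.
    rewrite -[act K g _]/(\val (sublevel_act hM s g _)) -natural_map_act.
    exact: image_natural_map.
  + by move=> p; rewrite slide0 //; exact: set_valP.
  + by move=> p; rewrite slide1 inverseK.
- have HP (xr : A * R) : I xr.2 -> A (slide hM s (\val xr.1, xr.2)).
    move=> Ir; have Ax := set_valP xr.1.
    by apply: (le_trans _ Ax); exact: slide_le.
  pose H (xr : A * R) : A :=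
    if pselect (I xr.2) is left Ir
    then exist (fun y => is_true (y \in A)) _ (mem_set (HP xr Ir)) else xr.1.
  have HE x r : I r -> \val (H (x, r)) = slide hM s (\val x, r).
    by move=> Ir; rewrite /H; case: pselect.
  exists H; split.
  + apply: within_into_subtype.
    apply: (@within_eq _ _ _ (fun xr : A * R => slide hM s (\val xr.1, xr.2))).
      by move=> [x r] [_ Ir]; rewrite HE.
    apply: (within_comp (B := A `*` I) (g := slide hM s)
      (f := fun xr : A * R => (\val xr.1, xr.2))).
    * by move=> [x r] [_ Ir]; split=> //; exact: set_valP.
    * apply: (within_pair (f := set_val \o fst) (g := snd)).
        apply: continuous_subspaceT => z.
        apply: (@continuous_comp _ A Y fst); first exact: cvg_fst.
        exact: (@initial_continuous A Y set_val).
      by apply: continuous_subspaceT => z; exact: cvg_snd.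
    * apply: (cw_within_prod (@closed_cell_compact _ _ _ K)) => [|j].
        exact: (sublevel_closed hM).
      exact: slide_continuous_cell.
  + move=> g x r Ir; apply: val_inj; rewrite HE //= HE //.
    by apply: act_slide => //; exact: set_valP.
  + move=> x; apply: val_inj; rewrite HE // slide0 ?kE //; exact: set_valP.
  + by move=> x; apply: val_inj; rewrite HE ?slide1 // /unit_interval /= ler01 lexx.
Qed.

End Inverse.

End NaturalMap.

Theorem mainTheorem3 (R : realType) (G : groupType) (Y : topologicalType)
    (K : affineGCW R G Y) (h : Y -> R) (hM : is_Gmorse K h) (t s : R)
    (lt_ts : t < s) (no_vertex : forall y, vertex K y -> ~ (t < h y < s)) :
  G_homotopy_equivalence R
    (morse_pushout_act hM (ltW lt_ts)) (sublevel_act hM s)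
    (natural_map K h (ltW lt_ts)).
Proof.
have [[p0]|noP] := pselect (inhabited (morse_pushout K h (ltW lt_ts))).
  exact: pushout_equivalence.
(* Otherwise the sublevel set is empty as well, because retr maps it to the
   image of the natural map. *)
apply: empty_equivalence => [|p|x]; first 1 last.
- by apply: noP; constructor.
- have Zx := retr_image hM t (set_valP x).
  by have [p _] := image_onto lt_ts no_vertex Zx; apply: noP.
- by split; [exact: natural_map_continuous|exact: natural_map_act].
Qed.
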